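(* Let $X_1, X_2, \ldots$ be i.i.d. random vectors in $\mathbb{R}^d$ with common cumulative distribution function $F$ having continuous margins $F_1,\ldots,F_d$ and copula $C$. For $j\in\{1,\ldots,d\}$ let $V_{d,j} = \{u\in[0,1]^d : 0<u_j<1\}$. Assume: (1) for each $j\in\{1,\ldots,d\}$, the first-order partial derivative $\dot{C}_j = \partial C/\partial u_j$ exists and is continuous on $V_{d,j}$; (2) for every $i,j\in\{1,\ldots,d\}$, the second-order partial derivative $\ddot{C}_{ij}$ of $C$ with respect to $u_i$ and $u_j$ is defined and continuous on $V_{d,i}\cap V_{d,j}$, and there exists a constant $K>0$ such that $$|\ddot{C}_{ij}(u)|\le K\min\left(\frac{1}{u_i(1-u_i)},\frac{1}{u_j(1-u_j)}\right),\qquad u\in V_{d,i}\cap V_{d,j}.$$ Let $\mathbb{C}_n = \sqrt n(C_n-C)$ be the empirical copula process and let $\tilde{\mathbb{C}}_n(u) = \alpha_n(u) - \sum_{j=1}^d\dot{C}_j(u)\,\alpha_{nj}(u_j)$ for $u\in[0,1]^d$. Then, almost surely, $$\sup_{u\in[0,1]^d}|\mathbb{C}_n(u)-\tilde{\mathbb{C}}_n(u)| = O\bigl(n^{-1/4}(\log n)^{1/2}(\log\log n)^{1/4}\bigr)\qquad(n\to\infty).$$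
   Context: Notation. Write $X_i = (X_{i1},\ldots,X_{id})$; $F(x) = C(F_1(x_1),\ldots,F_d(x_d))$. Order relations between vectors are componentwise. Empirical copula: $C_n(u) = F_n(F_{n1}^{-1}(u_1),\ldots,F_{nd}^{-1}(u_d))$ for $u\in[0,1]^d$, where $F_n(x) = \frac1n\sum_{i=1}^n \mathbf{1}\{X_i \le x\}$, $F_{nj}(x_j) = \frac1n\sum_{i=1}^n \mathbf{1}\{X_{ij}\le x_j\}$, and $F_{nj}^{-1}(u_j) = \inf\{x\in\mathbb{R} : F_{nj}(x)\ge u_j\}$ (so $F_{nj}^{-1}(0) = -\infty$, with $F_n=0$ whenever some argument is $-\infty$). Empirical processes: put $U_{ij} = F_j(X_{ij})$, $U_i = (U_{i1},\ldots,U_{id})$ (an i.i.d. sample from $C$), $G_n(u) = \frac1n\sum_{i=1}^n \mathbf{1}\{U_i\le u\}$, $G_{nj}(u_j) = \frac1n\sum_{i=1}^n\mathbf{1}\{U_{ij}\le u_j\}$, and $\alpha_n(u) = \sqrt n\,(G_n(u) - C(u))$, $\alpha_{nj}(u_j) = \sqrt n\,(G_{nj}(u_j) - u_j)$. Extension of partial derivatives: $\dot{C}_j$ is extended to all of $[0,1]^d$ by setting $\dot{C}_j(u) = \limsup_{h\downarrow 0} C(u+he_j)/h$ if $u_j = 0$ and $\dot{C}_j(u) = \limsup_{h\downarrow0}\{C(u) - C(u-he_j)\}/h$ if $u_j=1$, where $e_j$ is the $j$th coordinate vector in $\mathbb{R}^d$. The second-order partial derivative $\ddot{C}_{ij}$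 is the partial derivative of $\dot{C}_j$ with respect to $u_i$. *)

(* Defs.v *)
From HB Require Import structures.
From mathcomp Require Import all_boot all_order all_algebra finmap.
From mathcomp Require Import all_classical all_reals all_analysis.

Set Implicit Arguments.
Unset Strict Implicit.
Unset Printing Implicit Defensive.

Import Order.TTheory GRing.Theory Num.Theory.
Import numFieldNormedType.Exports.

Local Open Scope classical_set_scope.
Local Open Scope ring_scope.

(* Points of R^d are row vectors 'rV[R]_d (a normed space); random vectors take
   values in d.-tuple R (which carries the product sigma-algebra). *)

Definition mutually_independent dT (T : measurableType dT) (R : realType)
    (P : probability T R) dS (S : measurableType dS) (X : nat -> {RV P >-> S}) :
    Prop :=
  forall (J : {fset nat}) (B : nat -> set S),
    (forall i, measurable (B i)) ->
    P (\bigcap_(i in [set` J]) (X i @^-1` B i)) =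
    (\prod_(i <- J) P (X i @^-1` B i))%E.

Definition identically_distributed dT (T : measurableType dT) (R : realType)
    (P : probability T R) dS (S : measurableType dS) (X : nat -> {RV P >-> S}) :
    Prop :=
  forall (i k : nat) (B : set S),
    measurable B -> distribution P (X i) B = distribution P (X k) B.

Section distribution_functions.
Context {R : realType} {d : nat}.
Implicit Types (mu : probability (d.-tuple R) R) (C : 'rV[R]_d -> R).

Definition joint_cdf mu (x : 'rV[R]_d) : R :=
  fine (mu [set y : d.-tuple R | forall j, tnth y j <= x 0 j]).

Definition margin_cdf mu (j : 'I_d) (t : R) : R :=
  fine (mu [set y : d.-tuple R | tnth y j <= t]).

Definition cube : set 'rV[R]_d := [set u | forall j, 0 <= u 0 j <= 1].

(* A copula is the restriction to the unit cube of a distribution function with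
   standard uniform margins; the values of C outside the cube are irrelevant. *)
Definition is_copula C : Prop :=
  exists mu : probability (d.-tuple R) R,
    (forall j t, 0 <= t <= 1 -> margin_cdf mu j t = t) /\
    (forall u, cube u -> C u = joint_cdf mu u).

Definition copula_of C mu : Prop :=
  is_copula C /\
  forall x : 'rV[R]_d,
    joint_cdf mu x = C (\row_j margin_cdf mu j (x 0 j)).

End distribution_functions.

Section partial_derivatives.
Context {R : realType} {d : nat}.
Implicit Types (C : 'rV[R]_d -> R) (u : 'rV[R]_d).

Definition unit_vec (j : 'I_d) : 'rV[R]_d := delta_mx 0 j.

Definition Vset (j : 'I_d) : set 'rV[R]_d := cube `&` [set u | 0 < u 0 j < 1].

(* First-order partial derivative, extended to the faces u_j = 0 and u_j = 1.
   For a copula C the difference quotients lie in [0, 1], so that each limsup,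
   computed in \bar R, is finite. *)
Definition Cdot C (j : 'I_d) u : R :=
  if u 0 j == 0 then
    fine (limf_esup (fun h : R => (C (u + h *: unit_vec j) / h)%:E) 0^'+)
  else if u 0 j == 1 then
    fine (limf_esup (fun h : R => ((C u - C (u - h *: unit_vec j)) / h)%:E) 0^'+)
  else 'D_(unit_vec j) C u.

Definition Cddot C (i j : 'I_d) u : R := 'D_(unit_vec i) (Cdot C j) u.

End partial_derivatives.

(* The empirical quantities are functions of a fixed realization
   x = (x_0, x_1, ...) of the sample, of which they use x_0, ..., x_{n-1}. *)
Section empirical.
Context {R : realType} {d : nat}.
Implicit Types (x : nat -> d.-tuple R) (n : nat) (C : 'rV[R]_d -> R).

(* The argument is extended-real valued, since empirical quantiles may be -oo. *)
Definition emp_cdf x n (y : 'I_d -> \bar R) : R :=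
  n%:R^-1 * \sum_(i < n) ([forall j, ((tnth (x i) j)%:E <= y j)%E] : bool)%:R.

Definition emp_margin x n (j : 'I_d) (t : R) : R :=
  n%:R^-1 * \sum_(i < n) (tnth (x i) j <= t)%R%:R.

Definition emp_quantile x n (j : 'I_d) (p : R) : \bar R :=
  ereal_inf [set t%:E | t in [set t : R | p <= emp_margin x n j t]].

Definition emp_copula x n (u : 'rV[R]_d) : R :=
  emp_cdf x n (fun j => emp_quantile x n j (u 0 j)).

Definition emp_copula_process C x n (u : 'rV[R]_d) : R :=
  Num.sqrt n%:R * (emp_copula x n u - C u).

Definition margin_transform (mu : probability (d.-tuple R) R) x :
    nat -> d.-tuple R :=
  fun i => [tuple margin_cdf mu j (tnth (x i) j) | j < d].

Definition alpha C (U : nat -> d.-tuple R) n (u : 'rV[R]_d) : R :=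
  Num.sqrt n%:R * (emp_cdf U n (fun j => (u 0 j)%:E) - C u).

Definition alpha_margin (U : nat -> d.-tuple R) n (j : 'I_d) (t : R) : R :=
  Num.sqrt n%:R * (emp_margin U n j t - t).

Definition approx_process C (U : nat -> d.-tuple R) n (u : 'rV[R]_d) : R :=
  alpha C U n u - \sum_(j < d) Cdot C j u * alpha_margin U n j (u 0 j).

End empirical.

(* ln is 0 on nonpositive arguments, so that only n >= 3 is meaningful. *)
Definition rate (R : realType) (n : nat) : R :=
  n%:R `^ (- (1 / 4)) * ln n%:R `^ (1 / 2) * ln (ln n%:R) `^ (1 / 4).

(* f = O(g) as n -> oo: the library's bigO, for f with values in \bar R. *)
Definition ebigO (R : realType) (f : nat -> \bar R) (g : nat -> R) : Prop :=
  \forall k \near +oo%R, \forall n \near \oo, (`|f n| <= (k * `|g n|)%:E)%E.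

(* Main.v *)
Require Import Defs.
From HB Require Import structures.
From mathcomp Require Import all_boot all_order all_algebra finmap.
From mathcomp Require Import all_classical all_reals all_analysis.
From mathcomp Require Import measurable_realfun ring lra zify.

Set Implicit Arguments.
Unset Strict Implicit.
Unset Printing Implicit Defensive.

Import Order.TTheory GRing.Theory Num.Theory.
Import numFieldNormedType.Exports.

Local Open Scope classical_set_scope.
Local Open Scope ring_scope.

(* With a_n ~ sqrt(log log n / n) and l_n = log n / n, the rate divided by
   sqrt n is sqrt(a_n l_n).  Put v_j = F_j(F_nj^-1(u_j)).  Up to O(l_n), C_n(u)
   is G_n(v) and G_nj(v_j) is u_j, so |v - u| = O(a_n) by the law of the iterated
   logarithm, and boxes of measure O(a_n) deviate from their mean by
   O(sqrt(a_n l_n)).  Hence C_n - C - (G_n - C) is C(v) - C(u) up to that error.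
   Changing one coordinate of u at a time and using the mean value theorem,
   C(v) - C(u) is a sum of terms - Cdot_j(w) (G_nj(u_j) - u_j).  Replacing w by u
   costs O(a_n / m) |G_nj(u_j) - u_j| with m = min(u_j, 1 - u_j), by the bound on
   the second derivatives; as |G_nj(u_j) - u_j| = O(sqrt(m l_n)), this is
   O(sqrt(a_n l_n)) when m >= a_n, and when m < a_n each of the two terms is.

   All probabilistic inputs come from Chernoff's bound for the number of
   i <= n with U_i in a box, and the Borel-Cantelli lemma: a union bound over
   boxes with vertices in (1/n)Z^d gives the deviation of boxes; the law of the
   iterated logarithm, up to a constant, follows by dyadic chaining both in
   space and in the sample size. *)

(** * Chernoff bound for counts of independent events *)

(** The two logarithms come from two union bounds. Boxes with vertices in a grid of step 1/n are
    polynomially many in n, which costs log n in Chernoff's exponent. The uniform bound for the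
    margins has to be sharper, since it measures |v - u|: one exceptional event serves all sample
    sizes up to 2^K, so that summability over K is enough and the exponent is log K, of the order of
    log log n; chaining keeps the finer levels from adding to it. Chernoff's bound is Gaussian only
    while the exponent does not exceed the mean count. Smaller means are therefore enlarged, whence
    the deviation sqrt((delta + l) l) for a box of mass at most delta. The obstacle in the
    comparison of the two processes is the blow-up of the second derivatives at the faces u_j = 0
    and u_j = 1. It is offset by the vanishing of the marginal empirical process there, which must
    be used in the quantitative form sqrt(m l_n). Randomness is confined to three almost sure
    statements; the comparison is made at a fixed sample point. *)

Section chernoff_counts.
Context dT (T : measurableType dT) (R : realType) (P : probability T R).
Variables (A : nat -> set T) (p : R).
Hypothesis mA : forall i, measurable (A i).
Hypothesis PA : forall J : {fset nat},
  P (\bigcap_(i in [set` J]) A i) = (p ^+ #|` J|)%:E.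

Let prod_indic (z : R) (s : seq nat) w := \prod_(i <- s) (1 + z * \1_(A i) w).

Lemma measurable_prod_indic z s : measurable_fun setT (prod_indic z s).
Proof.
apply: measurable_prod => i _; apply: measurable_funD => //.
by apply: measurable_funM => //; apply: measurable_indic.
Qed.

Lemma integrable_prod_indic z s D : measurable D ->
  P.-integrable D (EFin \o prod_indic z s).
Proof.
move=> mD; apply: measurable_bounded_integrable => //.
- by rewrite (le_lt_trans (probability_le1 _ _)) ?ltry.
- exact/measurable_funTS/measurable_prod_indic.
exists ((1 + `|z|) ^+ size s); split; first exact: num_real.
move=> M /ltW ltM w _; apply: le_trans ltM.
rewrite /prod_indic; elim: s => [|i s IH].
  by rewrite big_nil normr1 expr0.
rewrite big_cons normrM /= exprS ler_pM //.
rewrite (le_trans (ler_normD _ _)) // normr1 lerD2l normrM indicE.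
by case: (w \in A i); rewrite ?normr1 ?mulr1 // normr0 mulr0.
Qed.

(** The induction on [s] is for all [J] at once: expanding the factor [1 + z * \1_(A i)] gives an
    integral over the same set and one over its intersection with [A i], which moves [i] from [s] to
    [J]. *)
Lemma integral_prod_indic z s (J : {fset nat}) :
  uniq s -> (forall i, i \in s -> i \notin J) ->
  (\int[P]_(w in \bigcap_(i in [set` J]) A i) (prod_indic z s w)%:E =
   (p ^+ #|` J| * (1 + z * p) ^+ size s)%:E)%E.
Proof.
elim: s J => [|i s IH] J /=.
  move=> _ _; rewrite /prod_indic expr0 mulr1.
  under eq_integral do rewrite big_nil.
  rewrite integral_cst; last by apply: bigcap_measurableType => k _; exact: mA.
  by rewrite mul1e; exact: PA.
move=> /andP[iNs us] sJ.
have mJ : measurable (\bigcap_(i in [set` J]) A i).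
  by apply: bigcap_measurableType => k _; exact: mA.
have iJ : i \notin J by apply: sJ; rewrite mem_head.
rewrite (_ : (fun w => _) = (fun w => ((prod_indic z s w)%:E +
    z%:E * ((prod_indic z s \_ (A i)) w)%:E)%E)); last first.
  apply/funext => w; rewrite /prod_indic big_cons -EFinM -EFinD patchE indicE.
  by congr EFin; case: (w \in A i) => /=;
    rewrite -?[point]/(0 : R); ring.
have int_i : P.-integrable (\bigcap_(i in [set` J]) A i)
    (EFin \o (prod_indic z s \_ (A i))).
  rewrite -restrict_EFin; apply/integrable_restrict => //.
  by apply: integrable_prod_indic; apply: measurableI.
rewrite integralD //; last 2 first.
- exact: integrable_prod_indic.
- exact: integrableZl.
rewrite integralZl // IH //; last first.
  by move=> k ks; apply: sJ; rewrite inE ks orbT.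
rewrite (_ : (fun w => _) = ((EFin \o prod_indic z s) \_ (A i))); last first.
  by rewrite restrict_EFin.
rewrite -integral_mkcondr.
rewrite (_ : _ `&` _ = \bigcap_(k in [set` (i |` J)%fset]) A k); last first.
  rewrite eqEsubset; split => w.
    by move=> [wJ wi] k /=; rewrite !inE => /orP[/eqP->//|/wJ].
  by move=> wJ; split => [k kJ|]; apply: wJ; rewrite /= !inE ?eqxx// kJ orbT.
rewrite IH //; last first.
  move=> k ks; rewrite !inE negb_or sJ ?inE ?ks ?orbT // andbT.
  by apply: contraNneq iNs => <-.
rewrite cardfsU1 iJ /= -EFinM -EFinD; congr EFin.
by rewrite exprD expr1 exprS; ring.
Qed.

(** Inverting [1 - x <= expR (- x)] bounds the exponential by 1 / (1 - x), and the right-hand side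
    times 1 - x equals 1 + x^2 (1 - 2x). *)
Lemma expR_le_quad (x : R) : `|x| <= 1 / 2 -> expR x <= 1 + x + 2 * x ^+ 2.
Proof.
rewrite ler_norml => /andP[x1 x2].
have h : 1 - x <= expR (- x) by exact: expR_ge1Dx.
have x0 : 0 < 1 - x by lra.
apply: (@le_trans _ _ (1 - x)^-1).
  by rewrite -[x in expR x]opprK expRN lef_pV2 // posrE ?expR_gt0.
rewrite -[_^-1]mul1r ler_pdivrMr //; nra.
Qed.

(** As e^(t 1_A) = 1 + (e^t - 1) 1_A, the integrand is a constant times [prod_indic]. Each factor of
    its integral is at most e^((e^t - 1 - t) p), hence at most e^(2 t^2 p). *)
Lemma integral_expR_count t s v : `|t| <= 1 / 2 -> (size s)%:R * p <= v ->
  0 <= p -> uniq s ->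
  (\int[P]_w (expR (t * \sum_(i <- s) (\1_(A i) w - p)))%:E <=
   (expR (2 * t ^+ 2 * v))%:E)%E.
Proof.
move=> t1 pv p0 us.
have expE w : expR (t * \sum_(i <- s) (\1_(A i) w - p)) =
    expR (- (t * p)) ^+ size s * prod_indic (expR t - 1) s w.
  rewrite /prod_indic mulr_sumr expR_sum.
  elim: s {pv us} => [|i s IH] /=; first by rewrite !big_nil expr0 mulr1.
  rewrite !big_cons IH exprS indicE.
  by case: (w \in A i) => /=; rewrite mulrBr expRD ?(mulr1, mulr0, expR0); ring.
under eq_integral do rewrite expE EFinM.
rewrite integralZl //; last exact: integrable_prod_indic.
have := @integral_prod_indic (expR t - 1) s fset0 us.
rewrite (_ : \bigcap_(i in _) A i = setT); last first.
  by rewrite -subTset => w _ i; rewrite /= inE.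
move=> -> //; rewrite cardfs0 expr0 mul1r -EFinM lee_fin -exprMn.
apply: (@le_trans _ _ (expR (2 * t ^+ 2 * p) ^+ size s)).
  rewrite lerXn2r ?nnegrE ?expR_ge0 //.
    rewrite mulr_ge0 ?expR_ge0 //.
    have : p <= 1.
      have := PA [fset 0%N]%fset; rewrite cardfs1 expr1 => /esym pE.
      by rewrite -lee_fin pE probability_le1 //; apply: bigcap_measurableType.
    by have := expR_gt0 t; nra.
  apply: (@le_trans _ _ (expR (- (t * p)) * expR ((expR t - 1) * p))).
    by rewrite ler_pM2l ?expR_gt0 // expR_ge1Dx.
  rewrite -expRD ler_expR.
  have := expR_le_quad t1; nra.
rewrite -expRM_natl ler_expR; have := sqr_ge0 t; nra.
Qed.

Lemma markov_expR_count t s v a : `|t| <= 1 / 2 -> (size s)%:R * p <= v ->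
  0 <= p -> uniq s ->
  (P [set w | (a <= t * \sum_(i <- s) (\1_(A i) w - p))%R] <=
   (expR (2 * t ^+ 2 * v - a))%:E)%E.
Proof.
move=> t1 pv p0 us; have := integral_expR_count t1 pv p0 us.
set S := fun w => _.
have mS : measurable_fun setT (fun w => t * \sum_(i <- s) (\1_(A i) w - p)).
  apply: measurable_funM => //; apply: measurable_sum => i.
  by apply: measurable_funB => //; apply: measurable_indic.
have mE : measurable [set w | a <= t * \sum_(i <- s) (\1_(A i) w - p)].
  by rewrite -[X in measurable X]setTI; exact: measurable_fun_ler.
move=> intS.
suff : ((expR a)%:E * P [set w | (a <= t * \sum_(i <- s) (\1_(A i) w - p))%R]
    <= (expR (2 * t ^+ 2 * v))%:E)%E.
  by rewrite expRB EFinM lee_pdivlMr ?expR_gt0 // muleC.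
apply: le_trans intS.
rewrite -[X in (P X)]setIT -integral_indic // -ge0_integralZl //; last first.
  exact/measurable_EFinP/measurable_indic.
apply: ge0_le_integral => //.
- apply/measurable_EFinP/measurable_funM => //; exact: measurable_indic.
- apply/measurable_EFinP; exact: measurableT_comp.
move=> w _; rewrite -EFinM lee_fin indicE; case: (boolP (w \in _)) => [|_].
  by rewrite inE /= mulr1 ler_expR.
by rewrite mulr0 expR_ge0.
Qed.

(** [v] is any upper bound of the mean count. The choice t = sqrt(x / v) / 2 is admissible because
    [x <= v], and the exponent becomes x/2 - (1 + 2c) x/2 = -cx. The factor 2 accounts for the two
    signs of the deviation. *)
Lemma chernoff_count s v x c : uniq s -> 0 < v -> 0 <= x <= v -> 0 <= c ->
  0 <= p -> (size s)%:R * p <= v ->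
  (P [set w | ((1 + 2 * c) * Num.sqrt (v * x) <=
               `|\sum_(i <- s) (\1_(A i) w - p)|)%R] <=
   (2 * expR (- (c * x)))%:E)%E.
Proof.
move=> us v0 /andP[x0 xv] c0 p0 pv.
set S := fun w => \sum_(i <- s) (\1_(A i) w - p).
pose t := Num.sqrt (x / v) / 2.
have t0 : 0 <= t by rewrite divr_ge0 ?sqrtr_ge0.
have t1 : `|t| <= 1 / 2.
  rewrite ger0_norm // ler_pM2r // -[leRHS]sqrtr1 ler_sqrt //.
  by rewrite ler_pdivrMr ?mul1r.
pose a := t * ((1 + 2 * c) * Num.sqrt (v * x)).
have t2 : t ^+ 2 * v = x / 4.
  rewrite exprMn sqr_sqrtr ?divr_ge0 ?(ltW v0) //.
  by field; rewrite gt_eqF.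
have aE : a = (1 + 2 * c) * x / 2.
  rewrite /a /t mulrCA -mulrA [_ / 2 * _]mulrAC [in X in X / 2]mulrC.
  rewrite -sqrtrM ?mulr_ge0 ?(ltW v0) //.
  rewrite (_ : v * x * (x / v) = x ^+ 2); last by field; rewrite gt_eqF.
  by rewrite sqrtr_sqr ger0_norm // mulrA.
have aE2 : 2 * t ^+ 2 * v - a = - (c * x).
  by rewrite aE -mulrA t2; field.
have bnd e : `|e| = 1 ->
    (P [set w | (a <= (e * t) * S w)%R] <= (expR (- (c * x)))%:E)%E.
  move=> e1; have e2 : e ^+ 2 = 1 by rewrite -real_normK ?num_real // e1 expr1n.
  have := @markov_expR_count (e * t) s v a.
  have -> : (e * t) ^+ 2 = t ^+ 2 by rewrite exprMn e2 mul1r.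
  by rewrite aE2 normrM e1 [1 * `|t|]mul1r; exact.
have mE e : measurable [set w | a <= (e * t) * S w].
  rewrite -[X in measurable X]setTI; apply: measurable_fun_ler => //.
  apply: measurable_funM => //; apply: measurable_sum => i.
  by apply: measurable_funB => //; apply: measurable_indic.
rewrite (_ : 2 * _ = expR (- (c * x)) + expR (- (c * x))); last by ring.
rewrite EFinD; apply: le_trans (leeD (bnd 1 _) (bnd (-1) _));
  rewrite ?normr1 ?normrN1 //.
apply: (le_trans _ (measureU2 _ _ _)) => //; apply: le_measure; rewrite ?inE.
- rewrite -[X in measurable X]setTI; apply: measurable_fun_ler => //.
  apply: measurableT_comp => //; apply: measurable_sum => i.
  by apply: measurable_funB => //; apply: measurable_indic.
- exact: measurableU.
move=> w /=; rewrite ler_normr => /orP[] h; [left|right];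
  rewrite /a ?mulN1r ?mul1r ?mulNr -?mulrN /=; exact: ler_wpM2l.
Qed.

End chernoff_counts.

(** * Boxes and coordinate changes *)

Section real_probability.
Context dY (Y : measurableType dY) (R : realType) (nu : probability Y R).
Implicit Types A B : set Y.

Definition pr A : R := fine (nu A).

Lemma prE A : measurable A -> (pr A)%:E = nu A.
Proof. by move=> mA; rewrite fineK // fin_num_measure. Qed.

Lemma pr_ge0 A : 0 <= pr A.
Proof. exact: fine_ge0. Qed.

Lemma pr_le1 A : measurable A -> pr A <= 1.
Proof. by move=> mA; rewrite -lee_fin prE // probability_le1. Qed.

Lemma le_pr A B : measurable A -> measurable B -> A `<=` B -> pr A <= pr B.
Proof.
by move=> mA mB AB; rewrite -lee_fin !prE //; apply: le_measure; rewrite ?inE.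
Qed.

Lemma prU A B : measurable A -> measurable B -> [disjoint A & B] ->
  pr (A `|` B) = pr A + pr B.
Proof.
move=> mA mB /disj_setPS AB; apply: EFin_inj.
rewrite EFinD !prE ?measureU //; last exact: measurableU.
by apply/seteqP; split => // y /AB.
Qed.

Lemma pr_split A B C : measurable A -> measurable B -> measurable C ->
  A `<=` C -> B `<=` C -> C `<=` A `|` B -> A `&` B `<=` set0 ->
  pr C = pr A + pr B.
Proof.
move=> mA mB mC AC BC CAB AB; rewrite -prU //; last exact/disj_setPS.
by congr pr; apply/seteqP; split => // y [/AC|/BC].
Qed.

End real_probability.

Definition setc {R : realType} {d} (u : 'rV[R]_d) (j : 'I_d) (b : R) : 'rV[R]_d :=
  \row_k (if k == j then b else u 0 k).

Section setc.
Context {R : realType} {d : nat}.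
Implicit Types (u v w : 'rV[R]_d) (j : 'I_d).

Lemma setcE u j b k : setc u j b 0 k = if k == j then b else u 0 k.
Proof. by rewrite mxE. Qed.

Lemma setc_eq u j b : setc u j b 0 j = b.
Proof. by rewrite setcE eqxx. Qed.

Lemma setc_id u j : setc u j (u 0 j) = u.
Proof. by apply/rowP => k; rewrite setcE; case: eqP => [->|]. Qed.

Lemma setcK u j a b : setc (setc u j a) j b = setc u j b.
Proof. by apply/rowP => k; rewrite !setcE; case: eqP. Qed.

Lemma setc_cube u j b : cube u -> 0 <= b <= 1 -> cube (setc u j b).
Proof. by move=> cu b01 k; rewrite setcE; case: eqP. Qed.

(* Passes from [u] to [v] by changing one coordinate at a time. *)
Lemma telescope_coord (phi : 'rV[R]_d -> R) u v (e D : 'I_d -> R) :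
  (forall j w, (forall k, w 0 k = u 0 k \/ w 0 k = v 0 k) -> w 0 j = u 0 j ->
     `|phi (setc w j (v 0 j)) - phi w - e j| <= D j) ->
  `|phi v - phi u - \sum_j e j| <= \sum_j D j.
Proof.
move=> H.
pose h m : 'rV[R]_d := \row_k (if (k < m)%N then v 0 k else u 0 k).
have hE m : (m <= d)%N ->
    `|phi (h m) - phi u - \sum_(j < d | (j < m)%N) e j| <=
      \sum_(j < d | (j < m)%N) D j.
  elim: m => [_|m IH md].
    rewrite !big_pred0 // (_ : h 0%N = u) ?subrr ?subr0 ?normr0 //.
    by apply/rowP => k; rewrite mxE.
  pose j := Ordinal md.
  have sE F : \sum_(i < d | (i < m.+1)%N) F i =
      F j + \sum_(i < d | (i < m)%N) F i :> R.
    rewrite (bigD1 j) //=; congr (_ + _); apply: eq_bigl => i.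
    by rewrite -val_eqE /= ltnS andbC -ltn_neqAle.
  rewrite !sE.
  have -> : h m.+1 = setc (h m) j (v 0 j).
    apply/rowP => k; rewrite setcE !mxE ltnS leq_eqVlt -val_eqE /=.
    by case: eqP => //= km; rewrite (_ : k = j) //; apply: val_inj.
  rewrite (_ : _ - _ - _ = (phi (setc (h m) j (v 0 j)) - phi (h m) - e j) +
    (phi (h m) - phi u - \sum_(i < d | (i < m)%N) e i)); last by ring.
  apply: le_trans (ler_normD _ _) (lerD (H _ _ _ _) (IH (ltnW md))).
    by move=> k; rewrite mxE; case: ifP; [right|left].
  by rewrite mxE ltnn.
have := hE d (leqnn d).
rewrite (_ : h d = v); last by apply/rowP => k; rewrite mxE ltn_ord.
have sT F : \sum_(j < d | (j < d)%N) F j = \sum_j F j :> R.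
  by apply: eq_bigl => j; rewrite ltn_ord.
by rewrite !sT.
Qed.

Lemma lipschitz_coord (phi : 'rV[R]_d -> R) u v :
  (forall j w, (forall k, w 0 k = u 0 k \/ w 0 k = v 0 k) -> w 0 j = u 0 j ->
     `|phi (setc w j (v 0 j)) - phi w| <= `|v 0 j - u 0 j|) ->
  `|phi v - phi u| <= \sum_j `|v 0 j - u 0 j|.
Proof.
move=> H; have := @telescope_coord phi u v (fun=> 0) (fun j => `|v 0 j - u 0 j|).
by rewrite sumr_const mul0rn subr0; apply => j w h1 h2; rewrite subr0; exact: H.
Qed.

End setc.

Section coordinate_laws.
Context dY (Y : measurableType dY) (R : realType) (nu : probability Y R).
Variables (d : nat) (f : 'I_d -> Y -> R).
Hypothesis mf : forall k, measurable_fun setT (f k).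
Hypothesis unif : forall k t, 0 <= t <= 1 -> pr nu [set y | f k y <= t] = t.

Implicit Types (u v : 'rV[R]_d) (j k : 'I_d).

Definition joint_set u := [set y | forall k, f k y <= u 0 k].

(** Bounded below in a single coordinate: its mass is the change of the distribution function when
    coordinate [j] moves from [a] to [u 0 j], the only change that occurs when coordinates are moved
    one at a time. *)
Definition box_set u j a :=
  [set y | (forall k, f k y <= u 0 k) /\ a < f j y].

Lemma measurable_le_coord k t : measurable [set y | f k y <= t].
Proof. by rewrite -[X in measurable X]setTI; exact: measurable_fun_ler. Qed.

Lemma measurable_gt_coord k t : measurable [set y | t < f k y].
Proof. by rewrite -[X in measurable X]setTI; exact: measurable_fun_ltr. Qed.

Lemma measurable_joint_set u : measurable (joint_set u).
Proof.
rewrite (_ : joint_set u =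
  \bigcap_(k in [set: 'I_d]) [set y | f k y <= u 0 k]); last first.
  apply/seteqP; split => [y H k _|y H k]; first exact: (H k).
  exact: (H k I).
by apply: fin_bigcap_measurable => // k _; exact: measurable_le_coord.
Qed.

Lemma box_setE u j a : box_set u j a = joint_set u `&` [set y | a < f j y].
Proof. by []. Qed.

Lemma measurable_box_set u j a : measurable (box_set u j a).
Proof.
rewrite box_setE; apply: measurableI; first exact: measurable_joint_set.
exact: measurable_gt_coord.
Qed.

Lemma pr_box_set u j a : a <= u 0 j ->
  pr nu (box_set u j a) = pr nu (joint_set u) - pr nu (joint_set (setc u j a)).
Proof.
move=> au; rewrite (@pr_split _ _ _ nu (box_set u j a) (joint_set (setc u j a))
  (joint_set u)) ?addrK //.
- exact: measurable_box_set.
- exact: measurable_joint_set.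
- exact: measurable_joint_set.
- by move=> y [].
- move=> y /= H k; have := H k; rewrite setcE; case: eqP => // -> /le_trans.
  exact.
- move=> y H; have [ya|ya] := leP (f j y) a; last by left.
  by right => k; rewrite setcE; case: eqP => // ->.
- by move=> y [[_ ay] /(_ j)]; rewrite setc_eq leNgt ay.
Qed.

(** Arguments outside [0, 1] do occur: rounding up to the grid used for boxes can give (n + 1) /
    n. *)
Lemma pr_le_clamp k t :
  pr nu [set y | f k y <= t] = Num.max 0 (Num.min t 1).
Proof.
have m t' := measurable_le_coord k t'.
have [t0|t0] := ltP t 0.
  rewrite min_l ?max_l; [|lra|lra].
  apply/eqP; rewrite eq_le pr_ge0 andbT.
  rewrite -[leRHS](@unif k 0) ?lexx ?ler01 //; apply: le_pr => // y /= /le_trans.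
  by apply; exact: ltW.
have [t1|t1] := leP t 1.
  by rewrite max_r // unif // t0.
rewrite max_r //; apply/eqP; rewrite eq_le pr_le1 //=.
rewrite -[leLHS](@unif k 1) ?lexx ?ler01 //; apply: le_pr => // y /= /le_trans.
by apply; exact: ltW.
Qed.

Lemma measurable_itv_coord k s t :
  measurable [set y | s < f k y /\ f k y <= t].
Proof.
apply: (@measurableI _ _ [set y | s < f k y] [set y | f k y <= t]).
  exact: measurable_gt_coord.
exact: measurable_le_coord.
Qed.

Lemma pr_itv_clamp k s t : s <= t ->
  pr nu [set y | s < f k y /\ f k y <= t] =
  Num.max 0 (Num.min t 1) - Num.max 0 (Num.min s 1).
Proof.
move=> st; rewrite -!(pr_le_clamp k).
apply/eqP; rewrite eq_sym subr_eq addrC; apply/eqP; apply: pr_split.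
- exact: measurable_le_coord.
- exact: measurable_itv_coord.
- exact: measurable_le_coord.
- by move=> y /= /le_trans; apply.
- by move=> y [].
- by move=> y /= yt; have [|] := leP (f k y) s; [left|right].
- by move=> y [/= ys [+ _]]; rewrite ltNge ys.
Qed.

Lemma pr_itv_le k s t : s <= t ->
  pr nu [set y | s < f k y /\ f k y <= t] <= t - s.
Proof.
move=> st; rewrite pr_itv_clamp // /Num.max /Num.min.
by case: (ltP t 1) => ?; case: (ltP s 1) => ?; case: ltP => ?; case: ltP => ?;
  lra.
Qed.

Lemma pr_itv k s t : 0 <= s -> s <= t -> t <= 1 ->
  pr nu [set y | s < f k y /\ f k y <= t] = t - s.
Proof.
move=> s0 st t1; rewrite pr_itv_clamp // !min_l ?max_r //.
- exact: le_trans st.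
- exact: le_trans t1.
Qed.

Lemma pr_box_set_le u j a : a <= u 0 j -> pr nu (box_set u j a) <= u 0 j - a.
Proof.
move=> au; apply: le_trans (pr_itv_le j au); apply: le_pr.
- exact: measurable_box_set.
- apply: (@measurableI _ _ [set y | a < f j y] [set y | f j y <= u 0 j]).
    exact: measurable_gt_coord.
  exact: measurable_le_coord.
- by move=> y [].
Qed.

Lemma pr_joint_coord_lip u j b :
  `|pr nu (joint_set (setc u j b)) - pr nu (joint_set u)| <= `|b - u 0 j|.
Proof.
wlog bu : u b / b <= u 0 j => [H|].
  have [/H//|/ltW ub] := leP b (u 0 j).
  have := H (setc u j b) (u 0 j); rewrite setc_eq setcK setc_id => /(_ ub).
  by rewrite distrC => /le_trans; apply; rewrite distrC.
rewrite distrC [leRHS]distrC -pr_box_set // ger0_norm ?pr_ge0 //.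
by rewrite ger0_norm ?subr_ge0 // pr_box_set_le.
Qed.

Lemma pr_joint_lip u v :
  `|pr nu (joint_set v) - pr nu (joint_set u)| <= \sum_j `|v 0 j - u 0 j|.
Proof.
apply: (lipschitz_coord (phi := fun u => pr nu (joint_set u))) => j w _ <-.
exact: pr_joint_coord_lip.
Qed.

End coordinate_laws.

(** * The law of the transformed sample *)

(** [F] may be constant on intervals. Taking the largest solution of [F x = t] makes the set where
    [F <= t] a half-line ending at [x]. *)
Lemma cdf_quantile {R : realType} (F : R -> R) t : continuous F ->
  {homo F : x y / x <= y} -> (exists a, F a < t) -> (exists b, t < F b) ->
  exists x, F x = t /\ forall y, (F y <= t) = (y <= x).
Proof.
move=> cF ndF [a Fa] [b Fb].
have ab : a <= b.
  by rewrite leNgt; apply/negP => /ltW /ndF; rewrite leNgt (lt_trans Fa).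
pose S := [set y | F y <= t].
have Sub y : S y -> y <= b.
  by move=> Sy; rewrite leNgt; apply/negP => /ltW /ndF; rewrite leNgt (le_lt_trans Sy).
have S0 : S !=set0 by exists a; exact: ltW.
have hS : has_ubound S by exists b.
have clS : closed S.
  by apply: (@closed_comp _ _ F [set z | z <= t]) => //; exact: closed_le.
have Sx : S (sup S) by apply: clS; exact: closure_sup.
have [c _ Fc] : exists2 c, c \in `[a, b] & F c = t.
  apply: IVT => //; first exact: continuous_subspaceT.
  by rewrite ge_min le_max (ltW Fa) (ltW Fb) orbT.
exists (sup S); split.
  apply/eqP; rewrite eq_le Sx /= -{1}Fc ndF //.
  by apply: ub_le_sup => //; rewrite /S /= Fc.
move=> y; apply/idP/idP => [Fy|/ndF Fy]; first exact: ub_le_sup.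
exact: le_trans Fy Sx.
Qed.

Section copula_law.
Context {R : realType} {d : nat}.
Implicit Types (mu : probability (d.-tuple R) R) (C : 'rV[R]_d -> R).
Implicit Types (u v : 'rV[R]_d) (j k : 'I_d).

Lemma measurable_tnth_le k (t : R) :
  measurable [set y : d.-tuple R | tnth y k <= t].
Proof.
rewrite -[X in measurable X]setTI; apply: measurable_fun_ler => //.
exact: measurable_tnth.
Qed.

Lemma margin_cdf_nd mu j : {homo margin_cdf mu j : x y / x <= y}.
Proof.
move=> x y xy; apply: le_pr; [exact: measurable_tnth_le..|].
by move=> z /= /le_trans; apply.
Qed.

Lemma margin_cdf_ge0 mu j t : 0 <= margin_cdf mu j t.
Proof. exact: pr_ge0. Qed.

Lemma margin_cdf_le1 mu j t : margin_cdf mu j t <= 1.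
Proof. by apply: pr_le1; exact: measurable_tnth_le. Qed.

Lemma margin_cdf_lims mu j t : 0 < t < 1 ->
  (exists a, margin_cdf mu j a < t) /\ (exists b, t < margin_cdf mu j b).
Proof.
move=> /andP[t0 t1].
pose Z : {RV mu >-> R} := mfun_Sub (mem_set (@measurable_tnth _ R d j)).
have ZE r : cdf Z r = (margin_cdf mu j r)%:E.
  rewrite /margin_cdf -/(pr _ _) prE; last exact: measurable_tnth_le.
  by rewrite /cdf /distribution /pushforward (_ : _ @^-1` _ = [set y | tnth y j <= r]).
have c0 : margin_cdf mu j x @[x --> -oo%R] --> (0 : R).
  by have := cvg_cdfNy0 Z; rewrite (funext ZE) => /fine_cvg.
have c1 : margin_cdf mu j x @[x --> +oo%R] --> (1 : R).
  by have := cvg_cdfy1 Z; rewrite (funext ZE) => /fine_cvg.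
split.
  have : \forall x \near -oo%R, margin_cdf mu j x < t by exact: (cvgr_lt _ c0).
  by case=> M [_ H]; exists (M - 1); apply: H; rewrite ltrBlDr ltrDl.
have : \forall x \near +oo%R, t < margin_cdf mu j x by exact: (cvgr_gt _ c1).
by case=> M [_ H]; exists (M + 1); apply: H; rewrite ltrDl.
Qed.

Definition margin_map mu k (y : d.-tuple R) := margin_cdf mu k (tnth y k).

Section law.
Variables (mu : probability (d.-tuple R) R) (C : 'rV[R]_d -> R).
Hypothesis margins_cont : forall j, continuous (margin_cdf mu j).

Let f := margin_map mu.

Lemma measurable_margin_map k : measurable_fun setT (f k).
Proof.
apply: (@measurableT_comp _ _ _ _ _ _ (margin_cdf mu k)).
  exact: continuous_measurable_fun.
exact: measurable_tnth.
Qed.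

Let mf := measurable_margin_map.

Lemma margin_quantile k t : 0 < t < 1 ->
  exists x, margin_cdf mu k x = t /\ forall y, (margin_cdf mu k y <= t) = (y <= x).
Proof.
move=> /(margin_cdf_lims mu k)[? ?]; apply: cdf_quantile => //.
exact: margin_cdf_nd.
Qed.

Lemma margin_map_unif_oo k t : 0 < t < 1 -> pr mu [set y | f k y <= t] = t.
Proof.
move=> /(margin_quantile k)[x [Fx xE]]; rewrite -[RHS]Fx; congr (fine (mu _)).
by apply/seteqP; split => y /=; rewrite /f /margin_map xE.
Qed.

Lemma margin_map_unif k t : 0 <= t <= 1 -> pr mu [set y | f k y <= t] = t.
Proof.
move=> /andP[t0 t1].
have m := measurable_le_coord mf k.
have [t1'|t1'] := ltP t 1; last first.
  have -> : t = 1 by apply/eqP; rewrite eq_le t1.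
  rewrite (_ : [set y | _] = setT) /pr ?probability_setT //.
  by rewrite -subTset => y _ /=; exact: margin_cdf_le1.
move: t0; rewrite le_eqVlt => /orP[/eqP <-|t0]; last first.
  by apply: margin_map_unif_oo; rewrite t0.
(* There may be no quantile at 0; the event is contained in the one at every small [e]. *)
apply/eqP; rewrite eq_le pr_ge0 andbT; apply/ler_addgt0Pr => e e0.
rewrite add0r; have [e1|e1] := ltP e 1; last first.
  by rewrite (le_trans _ e1) // pr_le1.
rewrite -[leRHS](@margin_map_unif_oo k) ?e0 //; apply: le_pr => // y /= /le_trans.
by apply; exact: ltW.
Qed.

Hypothesis C_copula : copula_of C mu.

(** The measure used is the witness of [is_copula], not [mu]: the law of the transformed sample is
    identified with [C] on the whole cube only later, and by means of this bound. *)
Lemma copula_lip u v : cube u -> cube v ->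
  `|C v - C u| <= \sum_j `|v 0 j - u 0 j|.
Proof.
case: C_copula => -[mu0 [unif CE]] _ cu cv; rewrite !CE //.
have unif' k t : 0 <= t <= 1 -> pr mu0 [set y | tnth y k <= t] = t by exact: unif.
have := @pr_joint_lip _ _ _ mu0 d (fun k y => tnth y k) _ unif' u v; apply => k.
exact: measurable_tnth.
Qed.

Lemma pr_joint_margin_oo u : (forall k, 0 < u 0 k < 1) ->
  pr mu (joint_set f u) = C u.
Proof.
move=> u01; have /choice[x xE] : forall k, exists x,
    margin_cdf mu k x = u 0 k /\ forall y, (margin_cdf mu k y <= u 0 k) = (y <= x).
  by move=> k; exact: margin_quantile.
case: C_copula => _ /(_ (\row_k x k)).
rewrite (_ : \row_j margin_cdf _ _ _ = u); last first.
  by apply/rowP => k; rewrite !mxE; case: (xE k).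
move=> <-; congr (fine (mu _)); apply/seteqP; split => y H k; have := H k;
  by rewrite mxE /f /margin_map; case: (xE k) => _ ->.
Qed.

(** Quantiles are at hand only strictly between 0 and 1, so [u] is first moved towards the centre of
    the cube, by at most [c] in each coordinate; both sides are Lipschitz. *)
Lemma pr_joint_margin u : cube u -> pr mu (joint_set f u) = C u.
Proof.
move=> cu; apply/eqP; rewrite -subr_eq0 -normr_le0; apply/ler_addgt0Pr => e e0.
rewrite add0r.
pose D := 2 * d%:R + 2 : R.
have D2 : 2 <= D by rewrite lerDr mulr_ge0.
have D0 : 0 < D by lra.
pose c := Num.min (1 / 4) (e / D).
have c0 : 0 < c by rewrite lt_min divr_gt0 ?divr_gt0.
have c4 : c <= 1 / 4 by rewrite ge_min lexx.
have cD : c * D <= e by rewrite -ler_pdivlMr // ge_min lexx orbT.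
pose v : 'rV[R]_d := \row_k ((1 - 2 * c) * u 0 k + c).
have vu k : `|v 0 k - u 0 k| <= c.
  rewrite mxE ler_norml; have /andP[? ?] := cu k; apply/andP; split; nra.
have sv : \sum_j `|v 0 j - u 0 j| <= d%:R * c.
  apply: (@le_trans _ _ (\sum_(j < d) c)); first by apply: ler_sum.
  by rewrite sumr_const card_ord mulr_natl.
have v01 k : 0 < v 0 k < 1.
  rewrite mxE; have /andP[? ?] := cu k; apply/andP; split; nra.
have cv : cube v by move=> k; have /andP[/ltW -> /ltW ->] := v01 k.
have h1 := copula_lip cu cv.
have h2 := pr_joint_lip mf margin_map_unif u v.
rewrite pr_joint_margin_oo // in h2.
rewrite (_ : _ - C u = (C v - C u) - (C v - pr mu (joint_set f u))); last by ring.
apply: le_trans (ler_normB _ _) _.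
rewrite /D in cD; move: (le_trans h1 sv) (le_trans h2 sv) => {}h1 {}h2.
lra.
Qed.

End law.
End copula_law.

(** * Borel-Cantelli and chaining *)

Section almost_sure.
Context dT (T : measurableType dT) (R : realType) (P : probability T R).

Lemma borel_cantelli_sq (E : nat -> set T) (M : R) :
  (forall n, measurable (E n)) ->
  (forall n, (0 < n)%N -> (P (E n) <= (M * n%:R ^- 2)%:E)%E) ->
  {ae P, forall w, exists N, forall n, (N <= n)%N -> ~ E n w}.
Proof.
(* The hypothesis does not bound the probability of [E 0], which is dropped by the shift. *)
move=> mE PE; pose F n := E n.+1.
have M0 : 0 <= M.
  by have := PE 1%N isT; rewrite expr1n invr1 mulr1 -lee_fin; exact: le_trans.
have sq2 m : \sum_(0 <= i < m.+1) (i.+1%:R ^- 2 : R) <= 2 - m.+1%:R^-1.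
  elim: m => [|m IH]; first by rewrite big_nat1 expr1n invr1; lra.
  rewrite big_nat_recr //=; apply: le_trans (lerD IH (lexx _)) _.
  have m1 : 0 < m.+1%:R :> R by [].
  rewrite -[m.+2%:R]natr1 -subr_ge0; set x := m.+1%:R in m1 *.
  rewrite (_ : _ - _ = x^-1 * (x + 1) ^- 2).
    by rewrite mulr_ge0 ?invr_ge0 ?exprn_ge0 ?(ltW m1) ?addr_ge0 ?(ltW m1).
  by field; rewrite !gt_eqF // addr_gt0.
have sumF : (\sum_(n <oo) P (F n) < +oo)%E.
  apply: (@le_lt_trans _ _ (M * 2)%:E); last by rewrite ltry.
  apply: lime_le; first exact: is_cvg_nneseries.
  apply: nearW => -[|m]; first by rewrite big_geq // lee_fin; lra.
  apply: (@le_trans _ _ (\sum_(0 <= i < m.+1) (M * i.+1%:R ^- 2)%:E)%E).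
    by apply: lee_sum => n _; exact: PE.
  rewrite sumEFin lee_fin -mulr_sumr ler_wpM2l // (le_trans (sq2 m)) //.
  by rewrite lerBlDr lerDl.
have mF n : measurable (F n) by exact: mE.
exists (lim_sup_set F); split.
- apply: bigcapT_measurable => n; apply: bigcup_measurable => k _.
  exact: mF.
- exact: lim_sup_set_cvg0.
move=> w /= nw N _; apply: contrapT => h; apply: nw; exists N.+1 => n Nn Enw.
by apply: h; exists n.-1; [rewrite /=|rewrite /F prednK //]; lia.
Qed.

(** Measurability is part of the conclusion so that the union bound can be iterated over nested
    existential quantifiers. *)
Lemma pr_exists_le (I : finType) (E : I -> set T) (b : I -> R) :
  (forall i, measurable (E i)) -> (forall i, (P (E i) <= (b i)%:E)%E) ->
  measurable [set w | exists i, E i w] /\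
  (P [set w | exists i, E i w] <= (\sum_i b i)%:E)%E.
Proof.
move=> mE PE.
have -> : [set w | exists i, E i w] = [set w | exists2 i, i \in enum I & E i w].
  by apply/seteqP; split => w [i]; exists i => //; rewrite mem_enum.
rewrite -big_enum /=; elim: (enum I) => [|i s [mIH IH]].
  rewrite big_nil (_ : [set w | _] = set0) ?measure0; first by split.
  by apply/seteqP; split => w // [].
rewrite big_cons (_ : [set w | _] = E i `|` [set w | exists2 i, i \in s & E i w]).
  split; first exact: measurableU.
  by rewrite EFinD; apply: le_trans (leeD (PE i) IH); exact: measureU2.
apply/seteqP; split => w /=.
  by move=> [k]; rewrite inE => /orP[/eqP->|ks] Ek; [left|right; exists k].
by move=> [Ei|[k ks Ek]]; [exists i|exists k]; rewrite ?inE ?eqxx ?ks ?orbT.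
Qed.

End almost_sure.

Section iid.
Context (R : realType) dT (T : measurableType dT) (P : probability T R).
Context dS (S : measurableType dS).
Variable X : nat -> {RV P >-> S}.
Hypothesis X_indep : mutually_independent X.
Hypothesis X_idd : identically_distributed X.

Let mu : probability S R := distribution P (X 0%N).

Lemma chernoff_iid (B : set S) s v x c : measurable B -> uniq s -> 0 < v ->
  0 <= x <= v -> 0 <= c -> (size s)%:R * pr mu B <= v ->
  (P [set w | ((1 + 2 * c) * Num.sqrt (v * x) <=
               `|\sum_(i <- s) (\1_B (X i w) - pr mu B)|)%R] <=
   (2 * expR (- (c * x)))%:E)%E.
Proof.
move=> mB us v0 xv c0 pv.
have mA i : measurable (X i @^-1` B).
  by rewrite -[X in measurable X]setTI; exact: measurable_funP.
have PXE i : P (X i @^-1` B) = (pr mu B)%:E.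
  by rewrite prE // -[LHS]/(distribution P (X i) B) (X_idd i 0%N).
have PA (J : {fset nat}) :
    P (\bigcap_(i in [set` J]) (X i @^-1` B)) = (pr mu B ^+ #|` J|)%:E.
  rewrite (X_indep J (fun=> mB)).
  under eq_bigr do rewrite PXE.
  by rewrite prodEFin big_const_seq count_predT iter_mulr_1.
have := chernoff_count mA PA us v0 xv c0 (pr_ge0 _ _) pv.
exact.
Qed.

Lemma measurable_dev (B : set S) s p y : measurable B ->
  measurable [set w | y <= `|\sum_(i <- s) (\1_B (X i w) - p)| :> R].
Proof.
move=> mB; rewrite -[X in measurable X]setTI; apply: measurable_fun_ler => //.
apply: measurableT_comp => //; apply: measurable_sum => i.
apply: measurable_funB => //.
apply: (@measurableT_comp _ _ _ _ _ _ (\1_B : S -> R)) => //.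
Qed.

End iid.

Lemma ln2_ge (R : realType) : 1 / 2 <= ln 2 :> R.
Proof.
rewrite -[1 / 2]expRK ler_ln ?posrE ?expR_gt0 //.
apply: le_trans (expR_le_quad _) _; last by rewrite expr2; lra.
by rewrite ger0_norm.
Qed.

(** Comparison with the term of degree m + 1 of the exponential series at (K + 1) ln 2. *)
Lemma exprn_le_pow2 (R : realType) m :
  exists2 B : R, 0 < B & forall K : nat, K.+1%:R ^+ m <= B * 2 ^+ K.
Proof.
exists (m.+1`!%:R * 2 / (ln 2) ^+ m.+1) => [|K].
  by rewrite divr_gt0 ?mulr_gt0 ?exprn_gt0 ?ltr0n ?fact_gt0 ?ln_gt0 // ltr1n.
have l2 : 0 < ln 2 :> R by rewrite ln_gt0 // ltr1n.
apply: (@le_trans _ _ (K.+1%:R ^+ m.+1)); first by rewrite exprS ler_peMl ?ler1n.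
rewrite [leRHS](_ : _ = (m.+1)`!%:R * 2 ^+ K.+1 / ln 2 ^+ m.+1); last first.
  by rewrite [2 ^+ K.+1]exprS mulrA mulrAC.
rewrite ler_pdivlMr ?exprn_gt0 // -exprMn.
have := @expR_ge1Dxn R (K.+1%:R * ln 2) m (mulr_ge0 (ler0n _ _) (ltW l2)).
rewrite expRM_natl lnK ?posrE // => h.
have : (K.+1%:R * ln 2) ^+ m.+1 / m.+1`!%:R <= 2 ^+ K.+1 :> R.
  by apply: le_trans h; rewrite lerDr.
by rewrite ler_pdivrMr ?ltr0n ?fact_gt0 // [X in _ <= X -> _]mulrC.
Qed.

(** Reading the binary digits of [k] from the most significant one leads from 0 to [k] with at most
    one increment of each dyadic level. *)
Lemma dyadic_chain (R : realType) (g : nat -> R) K (y : nat -> R) : g 0%N = 0 ->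
  (forall a l, (a <= K)%N -> (l < 2 ^ a)%N ->
     `|g (l.+1 * 2 ^ (K - a))%N - g (l * 2 ^ (K - a))%N| <= y a) ->
  forall k, (k <= 2 ^ K)%N -> `|g k| <= \sum_(a < K.+1) y a.
Proof.
move=> g0 H.
suff Hb b l : (b <= K)%N -> (l <= 2 ^ b)%N ->
    `|g (l * 2 ^ (K - b))%N| <= \sum_(a < b.+1) y a.
  by move=> k kK; have := Hb K k (leqnn _) kK; rewrite subnn expn0 muln1.
elim: b l => [|b IH] l bK lb.
  rewrite big_ord_recl big_ord0 addr0 /=.
  move: lb; rewrite expn0 leq_eqVlt => /orP[/eqP ->|].
    by have := H 0%N 0%N isT isT; rewrite mul0n g0 subr0.
  by rewrite ltnS leqn0 => /eqP ->; rewrite mul0n g0 normr0;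
    apply: le_trans (H 0%N 0%N isT isT).
have e2 : (2 ^ (K - b) = 2 * 2 ^ (K - b.+1))%N.
  by rewrite -expnS; congr (_ ^ _)%N; lia.
have lE : l = (odd l + l./2 * 2)%N by rewrite muln2 odd_double_half.
have lb2 : (l./2 <= 2 ^ b)%N by rewrite expnS in lb; lia.
have := IH _ (ltnW bK) lb2; rewrite e2 mulnA => h.
rewrite big_ord_recr /=; case: (boolP (odd l)) => ol; last first.
  have lE' : l = (l./2 * 2)%N by rewrite {1}lE (negPf ol).
  rewrite -lE' in h.
  apply: le_trans h _; rewrite lerDl.
  by apply: le_trans (H b.+1 0%N bK (expn_gt0 _ _)).
have lE' : l = (l./2 * 2).+1 by rewrite {1}lE ol add1n.
have l2b : (l./2 * 2 < 2 ^ b.+1)%N by rewrite -lE'.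
have := H b.+1 _ bK l2b; rewrite -lE' => h2.
rewrite addrC -[g (l * _)%N](subrK (g (l./2 * 2 * 2 ^ (K - b.+1))%N)).
by apply: le_trans (ler_normD _ _) _; exact: lerD.
Qed.

(** Multiplication by (1 - r)^2 collapses the sum to 1 minus a nonnegative remainder. *)
Lemma sum_geom_linear (R : realType) (r : R) n : 0 <= r < 1 ->
  \sum_(a < n) (a.+1%:R * r ^+ a) <= (1 - r) ^- 2.
Proof.
move=> /andP[r0 r1]; have r1' : 0 < 1 - r by rewrite subr_gt0.
have sE : (\sum_(a < n) (a.+1%:R * r ^+ a)) * (1 - r) ^+ 2 =
    1 - (n.+1%:R * r ^+ n - n%:R * r ^+ n.+1).
  elim: n => [|n IH]; first by rewrite big_ord0 mul0r expr0; ring.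
  by rewrite big_ord_recr /= mulrDl IH !exprS -!natr1; ring.
rewrite -[leRHS]mul1r ler_pdivlMr ?exprn_gt0 // sE gerBl subr_ge0.
rewrite exprS mulrA ler_wpM2r ?exprn_ge0 //.
by have := ler0n R n; rewrite -natr1; nra.
Qed.

Lemma sum_half_le (R : realType) n : \sum_(a < n) (1 / 2 : R) ^+ a <= 2.
Proof.
suff -> : \sum_(a < n) (1 / 2 : R) ^+ a = 2 - 2 * (1 / 2) ^+ n.
  by rewrite gerBl mulr_ge0 // exprn_ge0.
elim: n => [|n IH]; first by rewrite big_ord0 expr0; ring.
by rewrite big_ord_recr /= IH exprS; field.
Qed.

Lemma sqrtr_le (R : rcfType) (x y : R) : 0 <= y -> x <= y ^+ 2 -> Num.sqrt x <= y.
Proof. by move=> y0 xy; rewrite -(ger0_norm y0) -sqrtr_sqr ler_wsqrtr. Qed.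

Lemma le_sqrtr (R : rcfType) (x y : R) : 0 <= y -> y ^+ 2 <= x -> y <= Num.sqrt x.
Proof. by move=> y0 xy; rewrite -(ger0_norm y0) -sqrtr_sqr ler_wsqrtr. Qed.

Section chaining_sum.
Variable R : realType.

(* The Chernoff exponent for a time block of length 2^(K - a) and a cell of width
   2^-b: the summand a + b pays for the 2^(a + b) pairs of such blocks and cells. *)
Definition lvl K (a b : nat) : R := ln K%:R + (a + b)%:R.

(** The mean count, block length times cell width, enlarged by [lvl] so that the condition [x <= v]
    of [chernoff_count] holds. *)
Definition lvl_var K (a b : nat) : R := (2 ^ (K - a))%N%:R / 2 ^+ b + lvl K a b.

Lemma lvl_ge0 K a b : (0 < K)%N -> 0 <= lvl K a b.
Proof. by move=> K0; rewrite addr_ge0 // ln_ge0 // ler1n. Qed.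

Lemma ln_ge1 K : (4 <= K)%N -> 1 <= ln K%:R :> R.
Proof.
move=> K4; apply: (@le_trans _ _ (ln 4)).
  rewrite (_ : 4 = 2 ^+ 2 :> R) ?lnXn //; last by rewrite -natrX.
  by rewrite [ln 2 *+ 2]mulr2n; have := ln2_ge R; lra.
by rewrite ler_ln ?posrE ?ler_nat // ltr0n; lia.
Qed.

(** The Gaussian part is separated from the linear part. As ln K >= 1, [lvl K a b] is at most ln K
    (1 + a + b), hence at most ln K (a + 1)^2 (b + 1)^2; the Gaussian part thus factors, and its
    double sum is a product of two convergent series. *)
Lemma sqrt_lvl_le K a b : (4 <= K)%N -> (a <= K)%N ->
  Num.sqrt (lvl_var K a b * lvl K a b) <=
  Num.sqrt (2 ^+ K * ln K%:R) *
    ((a.+1%:R * Num.sqrt (1 / 2) ^+ a) * (b.+1%:R * Num.sqrt (1 / 2) ^+ b)) +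
  lvl K a b.
Proof.
move=> K4 aK; have L1 := ln_ge1 K4.
set r := Num.sqrt (1 / 2); have r2 : r ^+ 2 = 1 / 2 by rewrite sqr_sqrtr.
have r0 : 0 <= r by rewrite sqrtr_ge0.
set s := Num.sqrt (2 ^+ K * ln K%:R).
have s2 : s ^+ 2 = 2 ^+ K * ln K%:R.
  by rewrite sqr_sqrtr // mulr_ge0 ?exprn_ge0 // (le_trans _ L1).
have x0 : 0 <= lvl K a b by apply: lvl_ge0; lia.
set t := s * _; have t0 : 0 <= t by rewrite !mulr_ge0 ?sqrtr_ge0 ?exprn_ge0.
apply: sqrtr_le; first exact: addr_ge0.
rewrite /lvl_var mulrDl -expr2.
suff : (2 ^ (K - a))%N%:R / 2 ^+ b * lvl K a b <= t ^+ 2.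
  by have := mulr_ge0 t0 x0; nra.
rewrite /t !exprMn s2 -!exprM ![(_ * 2)%N]mulnC !exprM r2.
have -> : (2 ^ (K - a))%N%:R = 2 ^+ K * (1 / 2) ^+ a :> R.
  rewrite natrX -{2}(subnK aK) exprD -mulrA -exprMn.
  by rewrite (_ : 2 * _ = 1 :> R) ?expr1n ?mulr1 //; field.
have -> : (2 ^+ b)^-1 = (1 / 2) ^+ b :> R by rewrite -exprVn div1r.
set pa := (1 / 2) ^+ a; set pb := (1 / 2) ^+ b.
have p0 : 0 <= 2 ^+ K * pa * pb by rewrite !mulr_ge0 ?exprn_ge0.
rewrite (_ : _ * _ * (_ * _) = (2 ^+ K * pa * pb) *
  (ln K%:R * (a.+1%:R ^+ 2 * b.+1%:R ^+ 2))); last by ring.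
apply: ler_wpM2l => //.
rewrite /lvl natrD -!natr1; have := ler0n R a; have := ler0n R b.
set x := a%:R; set y := b%:R; set L := ln _ in L1 * => y0 x0'.
have xy : 0 <= x * y by exact: mulr_ge0.
apply: (@le_trans _ _ (L * (1 + x + y))); first by nra.
rewrite ler_wpM2l //; first lra.
have : 1 + x + y <= (x + 1) * (y + 1) by nra.
have : 1 <= (x + 1) * (y + 1) by nra.
rewrite -exprMn; set z := _ * _; nra.
Qed.

(** Up to a constant, the sum over all levels is no larger than the Gaussian deviation at the
    coarsest one. The 5 is the factor [1 + 2 * c] of [chernoff_count] for c = 2. *)
Lemma chaining_sum_le : exists2 B : R, 0 < B & forall K, (4 <= K)%N ->
  \sum_(a < K.+1) \sum_(b < K.+1) (5 * Num.sqrt (lvl_var K a b * lvl K a b)) <=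
  B * Num.sqrt (2 ^+ K * ln K%:R).
Proof.
(* The linear parts are (K + 1)^2 terms of size at most (K + 1)^3; comparing their sum with the
   square root of 2^K takes the power 10. *)
have [B0 B00 B0K] := @exprn_le_pow2 R 10.
pose r : R := Num.sqrt (1 / 2).
have r01 : 0 <= r < 1.
  rewrite sqrtr_ge0 /= -[ltRHS]sqrtr1 ltr_sqrt //; lra.
pose G := (1 - r) ^- 2.
have G0 : 0 <= G by rewrite invr_ge0 exprn_ge0 // subr_ge0 ltW; case/andP: r01.
exists (5 * (G * G + Num.sqrt B0)).
  by rewrite mulr_gt0 // ltr_wpDl ?mulr_ge0 ?sqrtr_gt0.
move=> K K4; have L1 := ln_ge1 K4.
set s := Num.sqrt (2 ^+ K * ln K%:R).
have s0 : 0 <= s by exact: sqrtr_ge0.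
have xle a b : (a <= K)%N -> (b <= K)%N -> lvl K a b <= K.+1%:R ^+ 3.
  move=> aK bK; rewrite /lvl.
  have lK : ln K%:R <= K%:R :> R.
    by apply/ltW/ln_sublinear; rewrite ltr0n; lia.
  have : (a + b)%:R <= 2 * K%:R :> R by rewrite -natrM ler_nat; lia.
  rewrite -natr1; have : 1 <= K%:R :> R by rewrite ler1n; lia.
  by set k := K%:R; nra.
apply: (@le_trans _ _ (5 * (s * ((\sum_(a < K.+1) a.+1%:R * r ^+ a) *
     (\sum_(b < K.+1) b.+1%:R * r ^+ b)) +
     \sum_(a < K.+1) \sum_(b < K.+1) K.+1%:R ^+ 3))).
  rewrite mulr_suml mulr_sumr -big_split mulr_sumr /=; apply: ler_sum => a _.
  rewrite !mulr_sumr -big_split mulr_sumr /=; apply: ler_sum => b _.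
  rewrite ler_wpM2l //.
  apply: (le_trans (sqrt_lvl_le b K4 _)); first by have := ltn_ord a; lia.
  rewrite lerD2l xle //; first by have := ltn_ord a; lia.
  by have := ltn_ord b; lia.
rewrite -mulrA ler_wpM2l // mulrDl [G * G * s]mulrC; apply: lerD.
  rewrite ler_wpM2l //; apply: ler_pM; rewrite ?sum_geom_linear //;
    apply: sumr_ge0 => a _; rewrite mulr_ge0 // exprn_ge0 //; by case/andP: r01.
rewrite !sumr_const card_ord -mulrnA -[leLHS]mulr_natl natrM -expr2 -exprD.
rewrite -sqrtrM ?(ltW B00) //; apply: le_sqrtr; first by rewrite exprn_ge0.
rewrite -exprM; apply: le_trans (B0K K) _.
rewrite ler_wpM2l ?(ltW B00) // ler_peMr // exprn_ge0 //.
Qed.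

End chaining_sum.

(** * Law of the iterated logarithm *)

Section iterated_logarithm.
Context (R : realType) dT (T : measurableType dT) (P : probability T R).
Context dS (S : measurableType dS).
Variable X : nat -> {RV P >-> S}.
Hypothesis X_indep : mutually_independent X.
Hypothesis X_idd : identically_distributed X.
Variables (d : nat) (f : 'I_d -> S -> R).
Hypothesis mf : forall k, measurable_fun setT (f k).
Hypothesis unif : forall k t, 0 <= t <= 1 ->
  pr (distribution P (X 0%N)) [set y | f k y <= t] = t.

Definition itv_coord j s t := [set y | s < f j y /\ f j y <= t].

Let q K (k : nat) : R := k%:R / 2 ^+ K.

Let blk K a l := index_iota (l * 2 ^ (K - a)) (l.+1 * 2 ^ (K - a)).

Let cell K j b m := itv_coord j (q K (m * 2 ^ (K - b))) (q K (m.+1 * 2 ^ (K - b))).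

(** With c = 2 the probability is at most 2 K^-2 4^-(a + b): this is still summable over levels
    after multiplication by the 2^(a + b) pairs of a block and a cell, and what remains is summable
    over [K]. *)
Let bad K (a b : 'I_K.+1) (l : 'I_(2 ^ a)) (m : 'I_(2 ^ b)) j :=
  [set w | (1 + 2 * 2) * Num.sqrt (lvl_var R K a b * lvl R K a b) <=
     `|\sum_(i <- blk K a l) (\1_(cell K j b m) (X i w) - (2 ^+ b)^-1)|].

Let q_cell K b m : (b <= K)%N ->
  q K (m.+1 * 2 ^ (K - b)) - q K (m * 2 ^ (K - b)) = (2 ^+ b)^-1.
Proof.
move=> bK; rewrite /q -mulrBl !natrM -mulrBl -natr1 addrAC subrr add0r mul1r.
by rewrite natrX -{2}(subnK bK) exprD invfM mulrA divff ?mul1r.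
Qed.

Let q_ge0 K k : 0 <= q K k.
Proof. by rewrite divr_ge0 // exprn_ge0. Qed.

Let q_le1 K k : (k <= 2 ^ K)%N -> q K k <= 1.
Proof.
by move=> kK; rewrite ler_pdivrMr ?exprn_gt0 // mul1r -natrX ler_nat.
Qed.

Let le_q K k k' : (k <= k')%N -> q K k <= q K k'.
Proof. by move=> kk; rewrite ler_wpM2r ?invr_ge0 ?exprn_ge0 // ler_nat. Qed.

Let dyadic_le K b m : (b <= K)%N -> (m < 2 ^ b)%N ->
  (m.+1 * 2 ^ (K - b) <= 2 ^ K)%N.
Proof.
by move=> bK mb; rewrite -[in leqRHS](subnKC bK) expnD leq_mul2r mb orbT.
Qed.

Let pr_cell K j b m : (b <= K)%N -> (m < 2 ^ b)%N ->
  pr (distribution P (X 0%N)) (cell K j b m) = (2 ^+ b)^-1.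
Proof.
move=> bK mb; rewrite -(q_cell m bK); apply: pr_itv => //.
  by apply: le_q; rewrite leq_mul2r leqnSn orbT.
exact/q_le1/dyadic_le.
Qed.

Let pr_bad K a b l m j : (0 < K)%N ->
  (P (@bad K a b l m j) <= (2 * K%:R ^- 2 * (1 / 4) ^+ (a + b))%:E)%E.
Proof.
move=> K0.
have aK : (a <= K)%N by rewrite -ltnS.
have bK : (b <= K)%N by rewrite -ltnS.
have x0 := @lvl_ge0 R K a b K0.
have v0 : 0 < (2 ^ (K - a))%N%:R / 2 ^+ b :> R.
  by rewrite divr_gt0 ?exprn_gt0 // ltr0n expn_gt0.
rewrite /bad -(pr_cell j bK (ltn_ord m)).
apply: le_trans (@chernoff_iid R _ T P _ S X X_indep X_idd (cell K j b m)
  (blk K a l) (lvl_var R K a b) (lvl R K a b) 2 _ _ _ _ _ _) _.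
- exact: measurable_itv_coord.
- exact: iota_uniq.
- exact: ltr_wpDr.
- by rewrite x0 /= lerDr ltW.
- by [].
- rewrite /blk size_iota -mulnBl subSnn mul1n pr_cell //.
  by rewrite lerDl.
rewrite lee_fin -mulrA ler_wpM2l // /lvl mulrDr opprD expRD.
apply: ler_pM; rewrite ?expR_ge0 //.
  by rewrite expRN expRM_natl lnK // posrE ltr0n.
rewrite expRN [2 * _]mulrC expRM_natl div1r exprVn lef_pV2 ?posrE ?exprn_gt0
  ?expR_gt0 // lerXn2r ?nnegrE ?expR_ge0 //.
have := @expR_ge1Dx R 1.
have -> : expR 2 = expR 1 ^+ 2 :> R by rewrite -expRM_natl mulr1.
by move: (expR 1) => e; rewrite expr2; nra.
Qed.

Let bad_union K := [set w | exists a b l m j, @bad K a b l m j w].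

Let measurable_bad K a b l m j : measurable (@bad K a b l m j).
Proof. by apply: measurable_dev; exact: measurable_itv_coord. Qed.

Let pr_bad_union K : (0 < K)%N ->
  measurable (bad_union K) /\
  (P (bad_union K) <= (8 * d%:R * K%:R ^- 2)%:E)%E.
Proof.
move=> K0; pose be a b : R := 2 * K%:R ^- 2 * (1 / 4) ^+ (a + b).
have Hj a b l m : measurable [set w | exists j, @bad K a b l m j w] /\
    (P [set w | exists j, @bad K a b l m j w] <=
      (\sum_(j < d) be a b)%:E)%E.
  by apply: pr_exists_le => j; [exact: measurable_bad|exact: pr_bad].
have Hm a b l := pr_exists_le (fun m => (Hj a b l m).1) (fun m => (Hj a b l m).2).
have Hl a b := pr_exists_le (fun l => (Hm a b l).1) (fun l => (Hm a b l).2).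
have Hb a := pr_exists_le (fun b => (Hl a b).1) (fun b => (Hl a b).2).
have [Ha1 Ha2] := pr_exists_le (fun a => (Hb a).1) (fun a => (Hb a).2).
split; first exact: Ha1.
apply: (le_trans Ha2); rewrite lee_fin.
have K2 : 0 <= 2 * K%:R ^- 2 :> R by rewrite mulr_ge0 // invr_ge0 exprn_ge0.
apply: (@le_trans _ _ (2 * K%:R ^- 2 * d%:R *
   ((\sum_(a < K.+1) (1 / 2) ^+ a) * (\sum_(b < K.+1) (1 / 2) ^+ b)))).
  rewrite mulr_suml mulr_sumr; apply: ler_sum => a _.
  rewrite !mulr_sumr; apply: ler_sum => b _.
  rewrite !sumr_const !card_ord -!mulrnA -[leLHS]mulr_natl /be !natrM !natrX.
  rewrite le_eqVlt; apply/orP; left; apply/eqP.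
  have e4 n : (1 / 4 : R) ^+ n = (1 / 2) ^+ n * (1 / 2) ^+ n.
    by rewrite -exprMn; congr (_ ^+ _); field.
  have e2 n : 2 ^+ n * (1 / 2) ^+ n = 1 :> R.
    by rewrite -exprMn (_ : 2 * _ = 1 :> R) ?expr1n //; field.
  rewrite exprD !e4.
  have := e2 a; have := e2 b.
  set A := 2 ^+ a; set A' := _ ^+ a; set B := 2 ^+ b; set B' := _ ^+ b => h1 h2.
  rewrite [LHS](_ : _ = 2 / K%:R ^+ 2 * d%:R * ((A * A') * A' * ((B * B') * B')));
    last by ring.
  by rewrite h1 h2 !mul1r.
rewrite (_ : 8 * d%:R * _ = 2 * K%:R ^- 2 * d%:R * (2 * 2)); last by ring.
rewrite ler_wpM2l ?mulr_ge0 //; apply: ler_pM; rewrite ?sum_half_le //;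
  by apply: sumr_ge0 => i _; rewrite exprn_ge0.
Qed.

(** Excluding the left endpoint 0 makes the deviation vanish at t = 0, where the chain in space
    starts. *)
Let dev j s t w : R := \sum_(i <- s) (\1_(itv_coord j 0 t) (X i w) - t).

Let itv_coordE j s t y :
  \1_(itv_coord j s t) y = ((s < f j y) && (f j y <= t))%:R :> R.
Proof.
rewrite indicE (_ : (y \in _) = (s < f j y) && (f j y <= t)) //.
by apply/idP/andP; rewrite inE.
Qed.

Let dev_sub j s t t' w : 0 <= t -> t <= t' ->
  dev j s t' w - dev j s t w =
  \sum_(i <- s) (\1_(itv_coord j t t') (X i w) - (t' - t)).
Proof.
move=> t0 tt; rewrite /dev -sumrB; apply: eq_bigr => i _.
rewrite !itv_coordE; set y := f j _.
by case: (ltP 0 y) => ?; case: (ltP t y) => ?; case: (leP y t') => ? /=;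
  try case: (leP y t) => ? /=; try lra.
Qed.

(** Two nested chains: the outer one splits the sample into blocks, the inner one splits the
    interval into cells for a fixed block. *)
Let dev_grid K w : ~ bad_union K w -> forall k n j, (k <= 2 ^ K)%N ->
  (n <= 2 ^ K)%N -> `|dev j (index_iota 0 n) (q K k) w| <=
  \sum_(a < K.+1) \sum_(b < K.+1) 5 * Num.sqrt (lvl_var R K a b * lvl R K a b).
Proof.
move=> nbad k n j kK nK.
apply: (@dyadic_chain _ (fun n => dev j (index_iota 0 n) (q K k) w) K
  (fun a => \sum_(b < K.+1) 5 * Num.sqrt (lvl_var R K a b * lvl R K a b))) => //.
  by rewrite /dev big_nil.
move=> a l aK la.
rewrite /dev (@big_cat_nat _ _ _ (l * 2 ^ (K - a))%N) //=; last first.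
  by rewrite leq_mul2r leqnSn orbT.
rewrite [X in `|X - _|]addrC addrK -/(blk K a l) -/(dev _ _ _ _).
apply: (@dyadic_chain _ (fun k => dev j (blk K a l) (q K k) w) K
  (fun b => 5 * Num.sqrt (lvl_var R K a b * lvl R K a b))) => //.
  rewrite /dev big1 // => i _; rewrite itv_coordE /q mul0r.
  by case: ltP => //= h; rewrite ?subr0 // leNgt h subr0.
move=> b m bK mb; rewrite dev_sub //; last first.
  by apply: le_q; rewrite leq_mul2r leqnSn orbT.
rewrite q_cell // leNgt; apply/negP => h; apply: nbad.
exists (Ordinal (aK : (a < K.+1)%N)), (Ordinal (bK : (b < K.+1)%N)).
exists (Ordinal la), (Ordinal mb), j => /=.
by rewrite /bad /= (_ : 1 + 2 * 2 = 5) ?ltW //; ring.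
Qed.

(** Counts are monotone in [t], and between neighbouring grid points the centring changes by at most
    n 2^-K <= 1. *)
Let dev_round K n j t w (Y : R) : (n <= 2 ^ K)%N -> 0 <= t <= 1 ->
  (forall k, (k <= 2 ^ K)%N -> `|dev j (index_iota 0 n) (q K k) w| <= Y) ->
  `|dev j (index_iota 0 n) t w| <= Y + 1.
Proof.
move=> nK /andP[t0 t1] H.
have K0 : 0 < 2 ^+ K :> R by rewrite exprn_gt0.
pose k := Num.truncn (t * 2 ^+ K).
have /andP[k1 k2] := truncn_itv (mulr_ge0 t0 (ltW K0)).
have kt : q K k <= t by rewrite ler_pdivrMr.
have tk : t <= q K k.+1 by rewrite ler_pdivlMr // ltW.
have qS : q K k.+1 = q K k + (2 ^+ K)^-1 by rewrite /q -natr1 mulrDl mul1r.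
have kK : (k <= 2 ^ K)%N.
  by rewrite -(ler_nat R) natrX (le_trans k1) // ler_piMl // ltW.
have nle : n%:R / 2 ^+ K <= 1 :> R.
  by rewrite ler_pdivrMr // mul1r -natrX ler_nat.
have mono s s' : 0 <= s -> s <= s' ->
    dev j (index_iota 0 n) s w <= dev j (index_iota 0 n) s' w + n%:R * (s' - s).
  move=> s0 ss.
  suff : - (n%:R * (s' - s)) <=
      dev j (index_iota 0 n) s' w - dev j (index_iota 0 n) s w by lra.
  rewrite dev_sub //; apply: (@le_trans _ _ (\sum_(i <- index_iota 0 n) (- (s' - s)))).
    by rewrite sumr_const_nat subn0 mulNrn mulr_natl.
  by apply: ler_sum => i _; rewrite lerDr itv_coordE.
have n0 : 0 <= n%:R :> R by [].
have := mono _ _ (q_ge0 K k) kt.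
have {}nle : n%:R * (2 ^+ K)^-1 <= 1 :> R by [].
have := H k kK; rewrite ler_norml => /andP[h1 h2] h3.
have h4 : n%:R * (t - q K k) <= 1.
  by apply: le_trans nle; rewrite ler_wpM2l // lerBlDl -qS.
rewrite ler_norml; apply/andP; split; first lra.
have [kK'|kK'] := leqP k.+1 (2 ^ K).
  have := mono _ _ t0 tk; have := H _ kK'; rewrite ler_norml => /andP[_ h5] h6.
  have h7 : n%:R * (q K k.+1 - t) <= 1.
    by apply: le_trans nle; rewrite ler_wpM2l // qS; lra.
  lra.
have tq : t = q K k.
  apply/eqP; rewrite eq_le kt andbT (le_trans t1) // /q.
  by rewrite ler_pdivlMr // mul1r -natrX ler_nat.
by rewrite tq; lra.
Qed.

(** Every [n] is handled by the level [K] with 2^(K - 1) <= n < 2^K; no maximal inequality is called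
    for, since the chain in the sample size reaches all n <= 2^K. *)
Lemma lil_ae : {ae P, forall w, exists A n0, 0 < A /\
  forall n j t, (n0 <= n)%N -> 0 <= t <= 1 ->
  `|\sum_(0 <= i < n) (\1_(itv_coord j 0 t) (X i w) - t)| <=
    A * Num.sqrt (n%:R * ln (ln n%:R))}.
Proof.
have [B B0 HB] := chaining_sum_le R.
pose E K := if (0 < K)%N then bad_union K else set0.
have mE K : measurable (E K).
  by rewrite /E; case: ifP => // K0; have [] := pr_bad_union K0.
have PE K : (0 < K)%N -> (P (E K) <= (8 * d%:R * K%:R ^- 2)%:E)%E.
  by move=> K0; rewrite /E K0; have [] := pr_bad_union K0.
apply: filterS (borel_cantelli_sq mE PE) => w [K0 HK].
(* The summand 1 pays for rounding to the grid; the factor 2 is the square root of 4, from 2^K <= 2n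
   and ln K <= 2 ln ln n. The 8 gives ln n >= 4. *)
exists (2 * (B + 1)), (2 ^ (K0 + 8))%N; split; first by rewrite mulr_gt0 ?addr_gt0.
move=> n j t nn t01; pose K1 := trunc_log 2 n; pose K := K1.+1.
have n1 : (0 < n)%N by apply: leq_trans nn; rewrite expn_gt0.
have /andP[Kn nK] := @trunc_log_bounds 2 n isT n1.
have KK : (K0 + 8 <= K1)%N by rewrite -ltnS -(@ltn_exp2l 2) // (leq_ltn_trans nn).
have K4 : (4 <= K)%N by rewrite /K; lia.
have L1 := ln_ge1 R K4.
have nbad : ~ bad_union K w by have := HK K; apply; rewrite /K; lia.
set l := ln n%:R.
have lK1 : K1%:R * (1 / 2) <= l.
  apply: (@le_trans _ _ (K1%:R * ln 2)); first by rewrite ler_wpM2l // ln2_ge.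
  rewrite mulr_natl -lnXn // ler_ln ?posrE ?exprn_gt0 ?ltr0n //.
  by rewrite -natrX ler_nat.
have K18 : 8 <= K1%:R :> R by rewrite ler_nat; lia.
have l4 : 4 <= l by lra.
(* Here K <= 2 l + 1 <= l^2, as l >= 4. *)
have lnK : ln K%:R <= 2 * ln l.
  rewrite mulr_natl -lnXn; last lra.
  by rewrite ler_ln ?posrE ?exprn_gt0 //; [rewrite /K -natr1; nra|lra].
have Kn2 : 2 ^+ K <= 2 * n%:R :> R by rewrite exprS ler_pM2l // -natrX ler_nat.
have K1' : 1 <= 2 ^+ K :> R by rewrite exprn_ege1 // ler1n.
have dv k : (k <= 2 ^ K)%N -> `|dev j (index_iota 0 n) (q K k) w| <=
    B * Num.sqrt (2 ^+ K * ln K%:R).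
  by move=> kK; apply: le_trans (HB K K4); apply: dev_grid => //; exact: ltnW.
apply: le_trans (dev_round (ltnW nK) t01 dv) _.
apply: (@le_trans _ _ ((B + 1) * Num.sqrt (2 ^+ K * ln K%:R))).
  rewrite mulrDl mul1r lerD2l; apply: le_sqrtr => //; rewrite expr1n; nra.
rewrite [2 * _]mulrC -mulrA ler_wpM2l ?addr_ge0 ?(ltW B0) //.
apply: sqrtr_le; first by rewrite mulr_ge0 ?sqrtr_ge0.
have ll : 0 <= ln l by apply: ln_ge0; lra.
rewrite exprMn sqr_sqrtr ?mulr_ge0 // expr2.
apply: (@le_trans _ _ ((2 * n%:R) * (2 * ln l))).
  by apply: ler_pM; [lra|lra|exact: Kn2|exact: lnK].
by rewrite le_eqVlt; apply/orP; left; apply/eqP; ring.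
Qed.

End iterated_logarithm.

(** * Deviations of boxes *)

Section box_deviations.
Context (R : realType) dT (T : measurableType dT) (P : probability T R).
Context dS (S : measurableType dS).
Variable X : nat -> {RV P >-> S}.
Hypothesis X_indep : mutually_independent X.
Hypothesis X_idd : identically_distributed X.
Variables (d : nat) (f : 'I_d -> S -> R).
Hypothesis mf : forall k, measurable_fun setT (f k).
Let mu : probability S R := distribution P (X 0%N).
Hypothesis unif : forall k t, 0 <= t <= 1 -> pr mu [set y | f k y <= t] = t.
Implicit Types (u : 'rV[R]_d) (j : 'I_d).

Let p u j a : R := pr mu (box_set f u j a).

Let dev n u j a w : R := \sum_(0 <= i < n) (\1_(box_set f u j a) (X i w) - p u j a).

(** Indices run up to n + 1 because the coordinate 1 is rounded up to (n + 1) / n. *)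
Let gv n (g : {ffun 'I_d -> 'I_n.+2}) : 'rV[R]_d := \row_k ((g k)%:R / n%:R).

Let ga n (k : 'I_n.+2) : R := k%:R / n%:R.

(** There are d (n + 2)^(d + 1) grid boxes, each bad with probability at most 2 n^-c; this choice
    leaves a multiple of n^-2. *)
Let c : R := (d + 3)%:R.

Let bad n g j k := [set w | (1 + 2 * c) *
  Num.sqrt ((n%:R * p (@gv n g) j (@ga n k) + ln n%:R) * ln n%:R) <=
  `|dev n (@gv n g) j (@ga n k) w|].

Let bad_union n := [set w | exists g j k, @bad n g j k w].

Let p_le u j a : a <= u 0 j -> p u j a <= u 0 j - a.
Proof. exact: pr_box_set_le. Qed.

Let measurable_bad n g j k : measurable (@bad n g j k).
Proof. by apply: measurable_dev; exact: measurable_box_set. Qed.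

Let pr_bad n g j k : (1 < n)%N ->
  (P (@bad n g j k) <= (2 * n%:R ^- (d + 3))%:E)%E.
Proof.
move=> n1; have l0 : 0 < ln n%:R :> R by rewrite ln_gt0 // ltr1n.
have np0 : 0 <= n%:R * p (gv g) j (ga k) by rewrite mulr_ge0 // pr_ge0.
apply: le_trans (@chernoff_iid R _ T P _ S X X_indep X_idd
  (box_set f (gv g) j (ga k)) (index_iota 0 n)
  (n%:R * p (gv g) j (ga k) + ln n%:R) (ln n%:R) c _ _ _ _ _ _) _.
- exact: measurable_box_set.
- exact: iota_uniq.
- exact: ltr_wpDl.
- by rewrite ltW //= lerDr.
- by [].
- by rewrite size_iota subn0 lerDl ltW.
rewrite lee_fin ler_wpM2l // expRN /c expRM_natl lnK // posrE ltr0n.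
exact: ltnW.
Qed.

Let pr_bad_union n : (1 < n)%N ->
  measurable (bad_union n) /\
  (P (bad_union n) <= (2 * d%:R * 3 ^+ d.+1 * n%:R ^- 2)%:E)%E.
Proof.
move=> n1; pose be : R := 2 * n%:R ^- (d + 3).
have Hk g j : measurable [set w | exists k, @bad n g j k w] /\
    (P [set w | exists k, @bad n g j k w] <= (\sum_(k < n.+2) be)%:E)%E.
  by apply: pr_exists_le => k; [exact: measurable_bad|exact: pr_bad].
have Hj g := pr_exists_le (fun j => (Hk g j).1) (fun j => (Hk g j).2).
have [Hg1 Hg2] := pr_exists_le (fun g => (Hj g).1) (fun g => (Hj g).2).
split; first exact: Hg1.
apply: (le_trans Hg2); rewrite lee_fin !sumr_const !card_ord card_ffun !card_ord.
rewrite -!mulrnA -[leLHS]mulr_natl !natrM /be.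
have n0 : 0 < n%:R :> R by rewrite ltr0n; exact: ltnW.
rewrite (_ : 2 * d%:R * 3 ^+ d.+1 * n%:R ^- 2 =
   (3 * n%:R) ^+ d.+1 * d%:R * (2 * n%:R ^- (d + 3))); last first.
  rewrite exprMn (_ : (d + 3 = d.+1 + 2)%N) ?[n%:R ^+ (_ + _)]exprD; last by lia.
  have : n%:R ^+ d.+1 != 0 :> R by rewrite expf_neq0 // gt_eqF.
  move: (n%:R ^+ d.+1) => z z0; field; rewrite z0 /= gt_eqF //.
apply: ler_wpM2r; first by rewrite mulr_ge0 ?invr_ge0 ?exprn_ge0.
rewrite (_ : _ * (_ * _) = n.+2%:R ^+ d.+1 * d%:R); last first.
  by rewrite natrX exprS; ring.
rewrite ler_wpM2r // lerXn2r ?nnegrE ?mulr_ge0 //.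
by rewrite -natrM ler_nat; lia.
Qed.

Let p_lip u u' j a a' (e : R) : a <= u 0 j -> a' <= u' 0 j ->
  (forall k, `|u' 0 k - u 0 k| <= e) -> `|a' - a| <= e ->
  `|p u' j a' - p u j a| <= 2 * d%:R * e.
Proof.
move=> au au' ue ae; rewrite /p !pr_box_set //.
have H (v v' : 'rV[R]_d) : (forall k, `|v' 0 k - v 0 k| <= e) ->
    `|pr mu (joint_set f v') - pr mu (joint_set f v)| <= d%:R * e.
  move=> ve; apply: le_trans (pr_joint_lip mf unif _ _) _.
  apply: (@le_trans _ _ (\sum_(k < d) e)); first exact: ler_sum.
  by rewrite sumr_const card_ord mulr_natl.
have h1 := H _ _ ue; have h2 : `|pr mu (joint_set f (setc u' j a')) -
    pr mu (joint_set f (setc u j a))| <= d%:R * e.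
  by apply: H => k; rewrite !setcE; case: eqP.
set x := _ - pr _ _ - _.
rewrite (_ : x = (pr mu (joint_set f u') - pr mu (joint_set f u)) -
  (pr mu (joint_set f (setc u' j a')) - pr mu (joint_set f (setc u j a))));
  last by rewrite /x; ring.
by apply: le_trans (ler_normB _ _) _; lra.
Qed.

(** Counts grow with the box, so only the centrings have to be compared; by [p_lip] they differ by
    O(1) when the vertices differ by at most 1/n. *)
Let le_dev n u u' j a a' w : box_set f u j a `<=` box_set f u' j a' ->
  dev n u j a w <= dev n u' j a' w + n%:R * (p u' j a' - p u j a).
Proof.
move=> BB; rewrite /dev !sumrB !sumr_const_nat subn0 -![p _ _ _ *+ n]mulr_natl.
suff : \sum_(0 <= i < n) (\1_(box_set f u j a) (X i w) : R) <=
  \sum_(0 <= i < n) \1_(box_set f u' j a') (X i w) by lra.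
apply: ler_sum => i _; rewrite !indicE.
case: (boolP (X i w \in box_set f u j a)) => [|_]; last by rewrite ler0n.
by rewrite inE => /BB h; rewrite mem_set.
Qed.

Lemma box_ae : {ae P, forall w, exists A n0, 0 < A /\
  forall n j u a, (n0 <= n)%N -> cube u -> 0 <= a <= u 0 j ->
  `|\sum_(0 <= i < n) (\1_(box_set f u j a) (X i w) - pr mu (box_set f u j a))| <=
    A * Num.sqrt ((n%:R * (u 0 j - a) + ln n%:R) * ln n%:R)}.
Proof.
pose E n := if (1 < n)%N then bad_union n else set0.
have mE n : measurable (E n).
  by rewrite /E; case: ifP => // n1; have [] := pr_bad_union n1.
have PE n : (0 < n)%N -> (P (E n) <= (2 * d%:R * 3 ^+ d.+1 * n%:R ^- 2)%:E)%E.
  move=> n0; rewrite /E; case: ifP => [n1|_]; first by have [] := pr_bad_union n1.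
  by rewrite measure0 lee_fin !mulr_ge0 ?invr_ge0 ?exprn_ge0.
apply: filterS (borel_cantelli_sq mE PE) => w [n0 Hn].
have c0 : 0 <= c by [].
(* The first summand bounds the deviation of the grid box, whose mean is at most n (u_j - a) + 2;
   the second is the discretization error, at most 2d. The 4 gives ln n >= 1, which absorbs both
   constants into the square root. *)
exists (2 * (1 + 2 * c) + 2 * d%:R), (n0 + 4)%N; split.
  by rewrite ltr_wpDr ?mulr_ge0 // mulr_gt0 // ltr_wpDr ?mulr_ge0.
move=> n j u a nn cu /andP[a0 au].
have n1 : (1 < n)%N by lia.
have nbad : ~ bad_union n w.
  by have := Hn n; rewrite /E n1; apply; lia.
have L1 : 1 <= ln n%:R :> R by apply: ln_ge1; lia.
have n0' : 0 < n%:R :> R by rewrite ltr0n; lia.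
set L := ln n%:R in L1 *; set del := u 0 j - a.
have del0 : 0 <= del by rewrite subr_ge0.
have L0 : 0 <= L by exact: le_trans L1.
have nd0 : 0 <= n%:R * del by rewrite mulr_ge0.
set Q := Num.sqrt _.
have Q1 : 1 <= Q.
  apply: le_sqrtr => //; rewrite expr1n; have := mulr_ge0 (ltW n0') del0; nra.
have grid (g : {ffun 'I_d -> 'I_n.+2}) (k : 'I_n.+2) :
    ga k <= gv g 0 j -> n%:R * (gv g 0 j - ga k) <= n%:R * del + 2 ->
    `|dev n (gv g) j (ga k) w| <= 2 * (1 + 2 * c) * Q.
  move=> kg gd; rewrite leNgt; apply/negP => h; apply: nbad.
  exists g, j, k; apply/ltW; apply: le_lt_trans h.
  rewrite (_ : 2 * (1 + 2 * c) * Q = (1 + 2 * c) * (2 * Q)); last by ring.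
  rewrite ler_wpM2l //; first by rewrite addr_ge0 ?mulr_ge0.
  apply: sqrtr_le; first by rewrite mulr_ge0 ?sqrtr_ge0.
  rewrite exprMn sqr_sqrtr; last first.
    by rewrite mulr_ge0 ?addr_ge0.
  rewrite mulrA ler_wpM2r // expr2.
  have : n%:R * p (gv g) j (ga k) <= n%:R * (gv g 0 j - ga k).
    by rewrite ler_wpM2l ?(ltW n0') // p_le.
  by rewrite -/L; lra.
have u01 k := andP (cu k).
pose tr (x : R) := Num.truncn (n%:R * x).
have trP x : 0 <= x -> (tr x)%:R / n%:R <= x < (tr x)%:R / n%:R + n%:R^-1.
  move=> x0; have := truncn_itv (mulr_ge0 (ltW n0') x0).
  rewrite -/(tr x) -{3}[n%:R^-1]mul1r -mulrDl natr1 => /andP[h1 h2].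
  by rewrite ler_pdivrMr // ltr_pdivlMr // [x * _]mulrC h1.
have trn x : 0 <= x <= 1 -> (tr x <= n)%N.
  move=> /andP[x0 x1]; rewrite -(ler_nat R).
  have /andP[h _] := truncn_itv (mulr_ge0 (ltW n0') x0).
  by apply: le_trans h _; rewrite ler_piMr // ltW.
have ni0 : 0 < n%:R^-1 :> R by rewrite invr_gt0.
have nni : n%:R * n%:R^-1 = 1 :> R by rewrite mulfV ?gt_eqF.
have fin u' a' : a' <= u' 0 j -> (forall k, `|u' 0 k - u 0 k| <= n%:R^-1) ->
    `|a' - a| <= n%:R^-1 -> n%:R * `|p u' j a' - p u j a| <= 2 * d%:R * Q.
  move=> h1 h2 h3; have := p_lip au h1 h2 h3.
  move=> /(ler_wpM2l (ltW n0')) /le_trans; apply.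
  by rewrite mulrCA nni mulr1 ler_peMr // mulr_ge0.
rewrite -/(p u j a) -/(dev n u j a w) mulrDl ler_norml; apply/andP; split.
- pose g := [ffun k => inord (tr (u 0 k)) : 'I_n.+2].
  (* The inner box needs its lower end rounded up, but not above its upper end; where the minimum is
     attained by the cap, the inner box is empty. *)
  pose k : 'I_n.+2 := inord (minn (tr a).+1 (tr (u 0 j))).
  have gE i : gv g 0 i = (tr (u 0 i))%:R / n%:R.
    by rewrite mxE ffunE inordK // ltnS ltnW // ltnS trn.
  have kE : ga k = (minn (tr a).+1 (tr (u 0 j)))%:R / n%:R.
    by rewrite /ga inordK // ltnS geq_min [X in _ || X]ltnW ?orbT // ltnS trn.
  have kg : ga k <= gv g 0 j.
    by rewrite kE gE ler_wpM2r ?(ltW ni0) // ler_nat geq_minr.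
  have ug i : `|gv g 0 i - u 0 i| <= n%:R^-1.
    have [h1 _] := u01 i; have /andP[h2 h3] := trP _ h1.
    by rewrite gE ler_norml; apply/andP; split; lra.
  have ak : `|ga k - a| <= n%:R^-1.
    have /andP[h2 h3] := trP _ a0.
    have : ga k <= (tr a)%:R / n%:R + n%:R^-1.
      rewrite kE -{3}[n%:R^-1]mul1r -mulrDl natr1 ler_wpM2r ?(ltW ni0) //.
      by rewrite ler_nat geq_minl.
    have : a - n%:R^-1 <= ga k.
      rewrite kE /minn; case: ifP => _.
        by rewrite -natr1 mulrDl mul1r; lra.
      by have := ug j; rewrite gE ler_norml => /andP[]; lra.
    by rewrite ler_norml => ? ?; apply/andP; split; lra.
  have sub : box_set f (gv g) j (ga k) `<=` box_set f u j a.
    move=> y [h1 h2]; split => [i|].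
      apply: le_trans (h1 i) _; rewrite gE.
      by have [h _] := u01 i; have /andP[] := trP _ h.
    move: h2; rewrite kE /minn; case: ifP => _ h2.
      have /andP[_ h3] := trP _ a0; apply: lt_trans h2.
      by rewrite -natr1 mulrDl mul1r.
    by have := h1 j; rewrite gE leNgt h2.
  have := le_dev n w sub; have := fin _ _ kg ug ak.
  have gd : n%:R * (gv g 0 j - ga k) <= n%:R * del + 2.
    have : gv g 0 j - ga k <= del + 2 * n%:R^-1.
      by have := ug j; move: ak; rewrite !ler_norml /del => /andP[? ?] /andP[? ?]; lra.
    move=> /(ler_wpM2l (ltW n0')).
    by rewrite [n%:R * (del + _)]mulrDr [n%:R * (2 * _)]mulrCA nni mulr1.
  have := grid g k kg gd; rewrite ler_norml => /andP[h1 _] h2 h3.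
  have : n%:R * (p u j a - p (gv g) j (ga k)) <= 2 * d%:R * Q.
    by apply: le_trans h2; rewrite ler_wpM2l ?(ltW n0') // distrC ler_norm.
  lra.
(* The outer box, for the upper bound: upper ends rounded up, lower end rounded down. *)
- pose g := [ffun k => inord (tr (u 0 k)).+1 : 'I_n.+2].
  pose k : 'I_n.+2 := inord (tr a).
  have gE i : gv g 0 i = (tr (u 0 i)).+1%:R / n%:R.
    by rewrite mxE ffunE inordK // !ltnS trn.
  have a1 : 0 <= a <= 1 by rewrite a0 (le_trans au) //; case: (u01 j).
  have kE : ga k = (tr a)%:R / n%:R.
    by rewrite /ga inordK // ltnS ltnW // ltnS trn.
  have /andP[a2 a3] := trP _ a0.
  have kg : ga k <= gv g 0 j.
    have [h1 _] := u01 j; have /andP[_ h2] := trP _ h1.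
    rewrite kE gE -natr1 mulrDl mul1r; lra.
  have ug i : `|gv g 0 i - u 0 i| <= n%:R^-1.
    have [h1 _] := u01 i; have /andP[h2 h3] := trP _ h1.
    by rewrite gE -natr1 mulrDl mul1r ler_norml; apply/andP; split; lra.
  have ak : `|ga k - a| <= n%:R^-1.
    by rewrite kE ler_norml; apply/andP; split; lra.
  have sub : box_set f u j a `<=` box_set f (gv g) j (ga k).
    move=> y [h1 h2]; split => [i|]; last by rewrite kE (le_lt_trans a2).
    apply: le_trans (h1 i) _; rewrite gE -natr1 mulrDl mul1r.
    by have [h _] := u01 i; have /andP[_ /ltW] := trP _ h.
  have := le_dev n w sub; have := fin _ _ kg ug ak.
  have gd : n%:R * (gv g 0 j - ga k) <= n%:R * del + 2.
    have : gv g 0 j - ga k <= del + 2 * n%:R^-1.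
      by have := ug j; move: ak; rewrite !ler_norml /del => /andP[? ?] /andP[? ?]; lra.
    move=> /(ler_wpM2l (ltW n0')).
    by rewrite [n%:R * (del + _)]mulrDr [n%:R * (2 * _)]mulrCA nni mulr1.
  have := grid g k kg gd; rewrite ler_norml => /andP[_ h1] h2 h3.
  have : n%:R * (p (gv g) j (ga k) - p u j a) <= 2 * d%:R * Q.
    by apply: le_trans h2; rewrite ler_wpM2l ?(ltW n0') // ler_norm.
  lra.
Qed.

End box_deviations.

(** * Mean value theorem and derivatives of a copula *)

Section coordinate_mvt.
Context {R : realType} {d : nat}.
Implicit Types (g : 'rV[R]_d -> R) (u v w : 'rV[R]_d) (i j k : 'I_d).

Lemma setc_shift u i s h : setc u i (h + s) = h *: unit_vec i + setc u i s.
Proof.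
apply/rowP => k; rewrite !mxE /unit_vec eqxx /=.
by case: eqP => _; rewrite ?mulr1 // mulr0 add0r.
Qed.

Lemma is_derive_setc g u i s : derivable g (setc u i s) (unit_vec i) ->
  is_derive s (1 : R) (fun t => g (setc u i t)) ('D_(unit_vec i) g (setc u i s)).
Proof.
move=> dg.
have E : (fun h : R => h^-1 *: (((fun t => g (setc u i t)) \o shift s) (h *: (1 : R)) -
      g (setc u i s))) =
    (fun h : R => h^-1 *: ((g \o shift (setc u i s)) (h *: unit_vec i) -
      g (setc u i s))).
  by apply/funext => h /=; rewrite -setc_shift /GRing.scale /= mulr1.
apply: DeriveDef; first by rewrite /derivable E.
by rewrite /derive E.
Qed.

Lemma continuous_setc u i : continuous (fun s : R => setc u i s).
Proof.
move=> s; have -> : (fun s => setc u i s) = (fun s => s *: unit_vec i + setc u i 0).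
  by apply/funext => t; rewrite -setc_shift addr0.
by apply: cvgD; [exact: scalel_continuous|exact: cvg_cst].
Qed.

Lemma within_continuous_setc g u i (A : set 'rV[R]_d) (B : set R) :
  {within A, continuous g} -> (forall s, B s -> A (setc u i s)) ->
  {within B, continuous (fun s => g (setc u i s))}.
Proof.
move=> /subspace_continuousP cg BA; apply/subspace_continuousP => s Bs.
apply: (@cvg_comp _ _ _ (fun s => setc u i s) g _ (within A (nbhs (setc u i s)))).
  move=> V AV.
  have : nbhs s (fun t => A (setc u i t) -> V (setc u i t)).
    exact: (@continuous_setc u i s _ AV).
  by move=> h; apply: (filterS _ h) => t AV' Bt; apply: AV'; exact: BA.
exact: (cg _ (BA _ Bs)).
Qed.

(** The endpoints come in either order because the displacement of an empirical quantile has no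
    fixed sign. *)
Lemma coord_mvt g u i a b :
  (forall s, Num.min a b < s < Num.max a b -> derivable g (setc u i s) (unit_vec i)) ->
  {within `[Num.min a b, Num.max a b], continuous (fun s => g (setc u i s))} ->
  a != b ->
  exists2 s, Num.min a b < s < Num.max a b &
    g (setc u i b) - g (setc u i a) = 'D_(unit_vec i) g (setc u i s) * (b - a).
Proof.
wlog ab : a b / a < b => [H|] dg cg.
  rewrite neq_lt => /orP[] ab.
    by apply: H => //; rewrite lt_eqF.
  have := H b a ab; rewrite [Num.min b a]minC [Num.max b a]maxC.
  case=> // [|s sab E]; first by rewrite lt_eqF.
  by exists s => //; rewrite -[LHS]opprB E -mulrN opprB.
move=> _; rewrite (min_l (ltW ab)) (max_r (ltW ab)) in dg cg *.
have [|s sab E] := @MVT R (fun s => g (setc u i s))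
    (fun s => 'D_(unit_vec i) g (setc u i s)) a b ab _ cg.
  by move=> s; rewrite in_itv /= => /dg /is_derive_setc.
by exists s => //; move: sab; rewrite in_itv.
Qed.

End coordinate_mvt.

Section copula_derivatives.
Context {R : realType} {d : nat}.
Variable C : 'rV[R]_d -> R.
Implicit Types (u v w : 'rV[R]_d) (i j k : 'I_d).
Hypothesis C_lip : forall u v, cube u -> cube v ->
  `|C v - C u| <= \sum_j `|v 0 j - u 0 j|.
Hypothesis C_diff1 : forall j,
  (forall u, Vset j u -> derivable C u (unit_vec j)) /\
  {within Vset j, continuous (Cdot C j)}.
Variable K : R.
Hypothesis K_gt0 : 0 < K.
Hypothesis C_diff2 : forall i j u, (Vset i `&` Vset j) u ->
  derivable (Cdot C j) u (unit_vec i) /\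
  `|Cddot C i j u| <= K * (1 / (u 0 j * (1 - u 0 j))).

Lemma CdotE j u : 0 < u 0 j < 1 -> Cdot C j u = 'D_(unit_vec j) C u.
Proof. by move=> /andP[u0 u1]; rewrite /Cdot gt_eqF // lt_eqF. Qed.

Lemma C_coord_lip j u b : cube u -> 0 <= b <= 1 ->
  `|C (setc u j b) - C u| <= `|b - u 0 j|.
Proof.
move=> cu b01; apply: le_trans (C_lip cu (setc_cube j cu b01)) _.
rewrite (bigD1 j) //= setc_eq big1 ?addr0 // => k kj.
by rewrite setcE (negPf kj) subrr normr0.
Qed.

(** The difference quotients are bounded by 1 as soon as the increment is too small to leave the
    cube. *)
Lemma Cdot_le1 j u : Vset j u -> `|Cdot C j u| <= 1.
Proof.
move=> [cu /= uj]; have [/(_ u (conj cu uj)) dC _] := C_diff1 j.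
rewrite CdotE //; case/andP: uj => u0 u1.
have dn : `|h^-1 *: ((C \o shift u) (h *: unit_vec j) - C u)| @[h --> 0^'] -->
    `|'D_(unit_vec j) C u| by exact: cvg_norm dC.
rewrite -(cvg_lim _ dn) //; apply: limr_le; first by apply/cvg_ex; eexists; exact: dn.
near=> h.
have h0 : h != 0 by near: h; exact: nbhs_dnbhs_neq.
have hm : `|h| < Num.min (u 0 j) (1 - u 0 j).
  by near: h; apply: dnbhs0_lt; rewrite lt_min u0 subr_gt0.
have /andP[h1 h2] : - Num.min (u 0 j) (1 - u 0 j) < h < Num.min (u 0 j) (1 - u 0 j).
  by rewrite -ltr_norml.
have h3 : Num.min (u 0 j) (1 - u 0 j) <= u 0 j by rewrite ge_min lexx.
have h4 : Num.min (u 0 j) (1 - u 0 j) <= 1 - u 0 j by rewrite ge_min lexx orbT.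
have -> : (C \o shift u) (h *: unit_vec j) = C (setc u j (h + u 0 j)).
  by rewrite setc_shift setc_id.
rewrite normrZ normfV ler_pdivrMl ?normr_gt0 // mulr1.
apply: le_trans (C_coord_lip j cu _) _; last by rewrite addrK.
by apply/andP; split; lra.
Unshelve. all: by end_near.
Qed.

Lemma within_continuous_C_setc w j a b : cube w -> 0 <= a -> b <= 1 ->
  {within `[a, b], continuous (fun s => C (setc w j s))}.
Proof.
move=> cw a0 b1; apply/subspace_continuousP => s /=; rewrite in_itv /= => /andP[s1 s2].
apply/cvgrPdist_le => e e0; rewrite near_withinE; near=> t => /=.
rewrite in_itv /= => /andP[t1 t2].
have c01 r : a <= r -> r <= b -> 0 <= r <= 1.
  by move=> ? ?; apply/andP; split; lra.
have := C_coord_lip j (setc_cube j cw (c01 _ t1 t2)) (c01 _ s1 s2).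
rewrite setcK setc_eq => /le_trans; apply.
near: t; have := @cvgr_dist_le _ _ _ (nbhs s) _ id s (@cvg_id _ _) e e0.
exact.
Unshelve. all: by end_near.
Qed.

Lemma itv_minmax (a b s : R) : 0 <= a <= 1 -> 0 <= b <= 1 ->
  Num.min a b < s < Num.max a b -> 0 < s < 1.
Proof.
move=> /andP[a0 a1] /andP[b0 b1]; rewrite gt_min lt_max.
by move=> /andP[/orP[] ? /orP[] ?]; apply/andP; split; lra.
Qed.

Lemma C_mvt j w b : cube w -> 0 < w 0 j < 1 -> 0 <= b <= 1 ->
  exists2 s, `|s - w 0 j| <= `|b - w 0 j| /\ 0 < s < 1 &
    C (setc w j b) - C w = Cdot C j (setc w j s) * (b - w 0 j).
Proof.
move=> cw w01 b01; have cwj := cw j.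
have [<-|wb] := eqVneq (w 0 j) b.
  by exists (w 0 j); rewrite ?subrr ?normr0 // setc_id subrr mulr0.
have [||//| s sab E] := @coord_mvt _ _ C w j (w 0 j) b.
- move=> s sab; have s01 := itv_minmax cwj b01 sab.
  apply: (C_diff1 j).1; split; last by rewrite /= setc_eq.
  by apply: setc_cube => //; case/andP: s01 => /ltW -> /ltW ->.
- apply: within_continuous_C_setc => //.
    by rewrite le_min; case/andP: cwj => -> _; case/andP: b01.
  by rewrite ge_max; case/andP: cwj => _ ->; case/andP: b01.
exists s; last by rewrite CdotE ?setc_eq ?(itv_minmax cwj b01) // -E setc_id.
split; last exact: itv_minmax sab.
move: sab; rewrite gt_min lt_max => sab; rewrite ler_norml.
have [ab|ab] := leP (w 0 j) b.
  rewrite (ger0_norm (_ : 0 <= b - w 0 j)) ?subr_ge0 //.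
  by move: sab => /andP[/orP[] ? /orP[] ?]; apply/andP; split; lra.
rewrite (ltr0_norm (_ : b - w 0 j < 0)) ?subr_lt0 //.
by move: sab => /andP[/orP[] ? /orP[] ?]; apply/andP; split; lra.
Qed.

(** [kap] bounds z_j (1 - z_j) from below at every point z of the segment: for i <> j the j-th
    coordinate is fixed, and for i = j the concavity of t (1 - t) reduces the claim to the
    endpoints. *)
Lemma Cdot_coord_lip i j w b kap : cube w -> 0 <= b <= 1 -> 0 < kap ->
  kap <= w 0 j * (1 - w 0 j) -> (i = j -> kap <= b * (1 - b)) ->
  `|Cdot C j (setc w i b) - Cdot C j w| <= K / kap * `|b - w 0 i|.
Proof.
move=> cw b01 kap0 kw kb; have cwi := cw i.
have [<-|wb] := eqVneq (w 0 i) b.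
  by rewrite setc_id !subrr !normr0 mulr0.
have in_V s : Num.min (w 0 i) b <= s <= Num.max (w 0 i) b ->
    Vset j (setc w i s) /\ kap <= (setc w i s) 0 j * (1 - (setc w i s) 0 j).
  rewrite ge_min le_max => sab.
  have kj : kap <= (setc w i s) 0 j * (1 - (setc w i s) 0 j).
    rewrite !setcE; case: eqP => [ji|//]; have {kb} := kb (esym ji).
    rewrite ji in kw => kb; have [c1|c1] := leP (w 0 i + b) 1;
      move: sab => /andP[/orP[] ? /orP[] ?]; nra.
  split => //; split; last first.
    rewrite /=; move: (setc w i s 0 j) kj => z zk.
    apply/andP; split; nra.
  apply: setc_cube => //; move: sab cwi b01.
  by move=> /andP[/orP[] ? /orP[] ?] /andP[? ?] /andP[? ?]; apply/andP; split; lra.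
have [||//| s sab E] := @coord_mvt _ _ (Cdot C j) w i (w 0 i) b.
- move=> s sab; have s01 := itv_minmax cwi b01 sab.
  apply: (@C_diff2 i j (setc w i s) _).1.
  have sab' : Num.min (w 0 i) b <= s <= Num.max (w 0 i) b.
    by case/andP: sab => /ltW -> /ltW ->.
  have [Vj _] := in_V _ sab'; split => //; split; first by case: Vj.
  by rewrite /= setc_eq.
- apply: (within_continuous_setc (C_diff1 j).2) => s.
  by rewrite /= in_itv /= => /in_V[].
have s01 := itv_minmax cwi b01 sab.
have sab' : Num.min (w 0 i) b <= s <= Num.max (w 0 i) b.
  by case/andP: sab => /ltW -> /ltW ->.
have [Vj kj] := in_V _ sab'.
have Vij : (Vset i `&` Vset j) (setc w i s).
  by split => //; split; [case: Vj|rewrite /= setc_eq].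
rewrite setc_id in E; rewrite E normrM ler_wpM2r //.
have [_ h] := C_diff2 Vij; apply: le_trans h _.
rewrite ler_wpM2l ?(ltW K_gt0) // div1r lef_pV2 ?posrE //.
exact: lt_le_trans kj.
Qed.

Lemma Cdot_lip j u w kap : cube u -> cube w -> 0 < kap ->
  kap <= u 0 j * (1 - u 0 j) -> kap <= w 0 j * (1 - w 0 j) ->
  `|Cdot C j w - Cdot C j u| <= K / kap * \sum_i `|w 0 i - u 0 i|.
Proof.
move=> cu cw kap0 ku kw; rewrite mulr_sumr.
have := @telescope_coord R d (Cdot C j) u w (fun=> 0)
  (fun i => K / kap * `|w 0 i - u 0 i|).
rewrite big1 // subr0; apply => i v vuw vi; rewrite subr0 -vi.
apply: Cdot_coord_lip => //.
- by move=> k; case: (vuw k) => ->.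
- by case: (vuw j) => ->.
- by move=> ->.
Qed.

End copula_derivatives.

(** * Deterministic bound *)

(** Right-continuity of the empirical distribution function in finite form; it makes the infimum
    defining the empirical quantile attained. *)
Lemma right_gap (R : realType) (z : nat -> R) q n :
  exists2 e : R, 0 < e & forall i, (i < n)%N -> q < z i -> q + e <= z i.
Proof.
elim: n => [|n [e e0 He]]; first by exists 1.
have [qz|zq] := ltP q (z n); last first.
  exists e => // i; rewrite ltnS leq_eqVlt => /orP[/eqP ->|/He //].
  by rewrite ltNge zq.
exists (Num.min e (z n - q)) => [|i]; first by rewrite lt_min e0 subr_gt0.
rewrite ltnS leq_eqVlt -lerBrDl ge_min => /orP[/eqP -> _|/He h /h].
  by rewrite lexx orbT.
by rewrite -lerBrDl => ->.
Qed.

Section empirical_facts.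
Context {R : realType} {d : nat}.
Implicit Types (x : nat -> d.-tuple R) (n : nat) (j : 'I_d).

Lemma emp_margin_ge0 x n j t : 0 <= emp_margin x n j t.
Proof. by rewrite mulr_ge0 ?invr_ge0 // sumr_ge0. Qed.

Lemma le_emp_margin x y n j s t :
  (forall i, (i < n)%N -> tnth (x i) j <= s -> tnth (y i) j <= t) ->
  emp_margin x n j s <= emp_margin y n j t.
Proof.
move=> H; rewrite ler_wpM2l ?invr_ge0 //; apply: ler_sum => i _.
by case: (tnth (x i) j <= s) (H i (ltn_ord i)) => // ->.
Qed.

Lemma emp_margin1 x n j t : (0 < n)%N ->
  (forall i, (i < n)%N -> tnth (x i) j <= t) -> emp_margin x n j t = 1.
Proof.
move=> n0 H; rewrite /emp_margin (eq_bigr (fun=> 1)); last first.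
  by move=> i _; rewrite H.
by rewrite sumr_const card_ord mulVf // pnatr_eq0 -lt0n.
Qed.

Lemma emp_margin0 x n j t :
  (forall i, (i < n)%N -> t < tnth (x i) j) -> emp_margin x n j t = 0.
Proof.
move=> H; rewrite /emp_margin big1 ?mulr0 // => i _.
by rewrite leNgt H.
Qed.

Lemma emp_quantile0 x n j : emp_quantile x n j 0 = -oo%E.
Proof.
have h r : (emp_quantile x n j 0 <= r%:E)%E.
  by apply: ereal_inf_lbound; exists r => //=; exact: emp_margin_ge0.
case E : (emp_quantile x n j 0) h => [r| |] // h.
  by exfalso; have := h (r - 1); rewrite lee_fin; lra.
by have := h 0.
Qed.

Lemma emp_quantileP x n j p : (0 < n)%N -> 0 < p <= 1 ->
  exists q : R, [/\ emp_quantile x n j p = q%:E, p <= emp_margin x n j q &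
    forall t, t < q -> emp_margin x n j t < p].
Proof.
move=> n0 /andP[p0 p1].
pose S := [set t : R | p <= emp_margin x n j t].
pose M := \sum_(i < n) `|tnth (x i) j|.
have xM i : (i < n)%N -> `|tnth (x i) j| <= M.
  by move=> ni; rewrite /M (bigD1 (Ordinal ni)) //= lerDl sumr_ge0.
have S0 : S !=set0.
  exists M; rewrite /S /= emp_margin1 // => i /xM; apply: le_trans.
  exact: ler_norm.
have lS : has_lbound S.
  exists (- M) => t; rewrite /S /= => pt; rewrite leNgt; apply/negP => tM.
  move: pt; rewrite emp_margin0 ?leNgt ?p0 // => i /xM.
  by rewrite ler_norml => /andP[h _]; exact: lt_le_trans h.
exists (inf S); split.
- by rewrite /emp_quantile ereal_inf_EFin.
- have [e e0 He] := right_gap (fun i => tnth (x i) j) (inf S) n.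
  have [t St tq] := inf_adherent e0 (conj S0 lS).
  apply: le_trans St _; apply: le_emp_margin => i ni xt.
  by rewrite leNgt; apply/negP => /(He _ ni); rewrite leNgt (le_lt_trans xt).
- move=> t tq; rewrite ltNge; apply/negP => St.
  by move: tq; rewrite ltNge ge_inf.
Qed.

End empirical_facts.

(** If the conjunctions differ, some coordinate already tells them apart. This reduces a joint count
    to marginal counts. *)
Lemma forall_indicator_gap (R : realDomainType) d (b b' : 'I_d -> bool) :
  (forall j, b j -> b' j) ->
  let D : R := ([forall j, b' j] : bool)%:R - ([forall j, b j] : bool)%:R in
  0 <= D <= \sum_j ((b' j)%:R - (b j)%:R).
Proof.
move=> bb /=; have t0 j : 0 <= (b' j)%:R - (b j)%:R :> R.
  by case: (b j) (bb j) => [->//|_]; rewrite ?subrr // subr0.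
have s0 : 0 <= \sum_j ((b' j)%:R - (b j)%:R) :> R by exact: sumr_ge0.
case: forallP => [B'|nB']; case: forallP => [B|nB]; rewrite ?subrr ?lexx ?s0 //.
  rewrite subr0 ler01 /=.
  have /existsP[j nbj] : [exists j, ~~ b j].
    by rewrite -negb_forall; apply/forallP.
  rewrite (bigD1 j) //= (B' j) (negPf nbj) subr0 lerDl; exact: sumr_ge0.
by case: nB' => j; exact/bb.
Qed.

Section deterministic_bound.
Context {R : realType} {d : nat}.
Variable C : 'rV[R]_d -> R.
Implicit Types (u v w : 'rV[R]_d) (j k : 'I_d).
Hypothesis C_lip : forall u v, cube u -> cube v ->
  `|C v - C u| <= \sum_j `|v 0 j - u 0 j|.
Hypothesis C_diff1 : forall j,
  (forall u, Vset j u -> derivable C u (unit_vec j)) /\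
  {within Vset j, continuous (Cdot C j)}.
Variable K : R.
Hypothesis K_gt0 : 0 < K.
Hypothesis C_diff2 : forall i j u, (Vset i `&` Vset j) u ->
  derivable (Cdot C j) u (unit_vec i) /\
  `|Cddot C i j u| <= K * (1 / (u 0 j * (1 - u 0 j))).

Variable F : 'I_d -> R -> R.
Hypothesis F_nd : forall j, {homo F j : s t / s <= t}.
Hypothesis F01 : forall j t, 0 <= F j t <= 1.
Hypothesis F_quantile : forall j t, 0 < t < 1 ->
  exists z, F j z = t /\ forall y, (F j y <= t) = (y <= z).

Variables (x : nat -> d.-tuple R) (n : nat).
Hypothesis n_gt0 : (0 < n)%N.
Let U : nat -> d.-tuple R := fun i => [tuple F j (tnth (x i) j) | j < d].
Let G j t := emp_margin U n j t.
Let E u := emp_cdf U n (fun k => (u 0 k)%:E).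

Variables (a l A : R).
Hypothesis l_gt0 : 0 < l.
Hypothesis le_la : l <= a.
Hypothesis A_ge0 : 0 <= A.
(** The modulus for increments over length [delta]; [l] stands for log n / n, and [a] for the
    uniform bound of the law of the iterated logarithm. *)
Let b (delta : R) := A * Num.sqrt ((delta + l) * l).

Hypothesis U_gt0 : forall i j, 0 < tnth (U i) j.
Hypothesis G_unif : forall j t, 0 <= t <= 1 -> `|G j t - t| <= a.
Hypothesis G_incr : forall j s t, 0 <= s -> s <= t -> t <= 1 ->
  `|G j t - G j s - (t - s)| <= b (t - s).
Hypothesis E_incr : forall j u s, cube u -> 0 <= s <= u 0 j ->
  `|E u - E (setc u j s) - (C u - C (setc u j s))| <= b (u 0 j - s).

Let a_gt0 : 0 < a := lt_le_trans l_gt0 le_la.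
(** Chosen so that l + b(l) <= [c1] l, which bounds the jumps of [G]; adding the uniform bound [a]
    leads to |v_j - u_j| <= [c2] a. *)
Let c1 : R := 1 + 2 * A.
Let c2 : R := 2 + 2 * A.
Let rho := Num.sqrt (a * l).

Let c1_ge1 : 1 <= c1. Proof. by rewrite /c1; have := A_ge0; lra. Qed.

Let U_le1 i j : tnth (U i) j <= 1.
Proof. by rewrite tnth_mktuple; case/andP: (F01 j (tnth (x i) j)). Qed.

Let b_le delta m : 0 <= m -> (delta + l) * l <= m ^+ 2 -> b delta <= A * m.
Proof. by move=> m0 h; rewrite ler_wpM2l // sqrtr_le. Qed.

Let rho2 : rho ^+ 2 = a * l.
Proof. by rewrite sqr_sqrtr // mulr_ge0 // ltW. Qed.

Let rho_ge0 : 0 <= rho. Proof. exact: sqrtr_ge0. Qed.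

Let l_le_rho : l <= rho.
Proof.
apply: le_sqrtr; first exact: ltW.
by rewrite expr2 ler_wpM2r // ltW.
Qed.

Let b_rho c delta : 0 <= c -> delta <= c * a -> b delta <= A * (c + 1) * rho.
Proof.
move=> c0 dc; rewrite -mulrA; apply: b_le.
  by rewrite mulr_ge0 // addr_ge0.
rewrite exprMn rho2 mulrA ler_wpM2r ?(ltW l_gt0) //.
have := a_gt0; have := le_la; nra.
Qed.

Let G0 j : G j 0 = 0.
Proof. by apply: emp_margin0 => i _; exact: U_gt0. Qed.

Let G1 j : G j 1 = 1.
Proof. by apply: emp_margin1. Qed.

(** [v] is F_j at the empirical quantile q, or 0 if p = 0, when the quantile is -oo and no [U] is at
    most 0. Applying F_j can enlarge the event X_ij <= q, as F_j may be constant to the right of q;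
    the last clause bounds the excess without excluding flat pieces or ties. *)
Lemma quantile_coord j (p : R) : 0 <= p <= 1 ->
  exists v : R, [/\ 0 <= v <= 1, `|G j v - p| <= c1 * l,
    forall i, ((tnth (x i) j)%:E <= emp_quantile x n j p)%E -> tnth (U i) j <= v &
    n%:R^-1 * (\sum_(i < n) ((tnth (U i) j <= v)%R%:R -
      ((tnth (x i) j)%:E <= emp_quantile x n j p)%E%:R)) <= c1 * l].
Proof.
move=> /andP[p0 p1]; have cl0 : 0 <= c1 * l.
  by rewrite mulr_ge0 ?(ltW l_gt0) // (le_trans ler01).
move: p0; rewrite le_eqVlt => /orP[/eqP <-|p0].
  exists 0; rewrite emp_quantile0; split => //.
  - by rewrite lexx ler01.
  - by rewrite G0 subrr normr0.
  - rewrite big1 ?mulr0 // => i _; rewrite leNgt U_gt0 /=.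
    by rewrite subrr.
have [|q [qE pq qp]] := @emp_quantileP R d x n j p n_gt0; first by rewrite p0.
have Gs s : 0 < s < 1 -> s < F j q -> G j s <= p.
  move=> s01 sq; have [z [Fz zE]] := F_quantile j s01.
  have zq : z < q by rewrite ltNge -(rwP negP) => /(F_nd j); rewrite Fz leNgt sq.
  apply: le_trans (ltW (qp _ zq)); apply: le_emp_margin => i _.
  by rewrite tnth_mktuple zE.
have Gv : p <= G j (F j q).
  apply: le_trans pq _; apply: le_emp_margin => i _ h.
  by rewrite tnth_mktuple F_nd.
have /andP[v0 v1] := F01 j q.
have b1 t : t <= l -> b t <= 2 * A * l.
  move=> tl; rewrite [2 * A]mulrC -mulrA; apply: b_le; first by rewrite mulr_ge0 // ltW.
  by have := l_gt0; nra.
(* To the left of v the value of [G] is at most [p]. Hence v is compared with v - l, or with 0 when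
   v <= l. *)
have Gv' : G j (F j q) - p <= c1 * l.
  have [vl|lv] := leP (F j q) l.
    have := G_incr j (lexx 0) v0 v1; rewrite G0 !subr0 ler_norml => /andP[_ h].
    by have := b1 _ vl; rewrite /c1; lra.
  have s0 : 0 < F j q - l by rewrite subr_gt0.
  have := Gs (F j q - l); rewrite s0 => Gsl.
  have l0 := l_gt0.
  have h0 : G j (F j q - l) <= p by apply: Gsl => /=; lra.
  have sv : F j q - l <= F j q by lra.
  have := G_incr j (ltW s0) sv v1.
  rewrite (_ : F j q - (F j q - l) = l) ?ler_norml; last by ring.
  by move=> /andP[_ h]; have := b1 l (lexx _); rewrite /c1; lra.
exists (F j q); split => //.
- by rewrite ger0_norm // subr_ge0.
- by move=> i; rewrite qE lee_fin => h; rewrite tnth_mktuple F_nd.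
rewrite sumrB mulrBr -/(emp_margin U n j (F j q)) -/(G j (F j q)).
under [X in _ - _ * X]eq_bigr do rewrite qE lee_fin.
rewrite -/(emp_margin x n j q); apply: le_trans Gv'; lra.
Qed.


Let E_osc w j t : cube w -> 0 <= t <= 1 ->
  `|E (setc w j t) - E w - (C (setc w j t) - C w)| <= b `|t - w 0 j|.
Proof.
move=> cw t01; have [tw|/ltW wt] := leP t (w 0 j).
  rewrite distrC [in b _]distrC [in b _]ger0_norm ?subr_ge0 //.
  have := @E_incr j w t cw; case/andP: t01 => -> _; rewrite tw => /(_ isT).
  by rewrite (_ : E w - _ - _ = C (setc w j t) - C w - (E (setc w j t) - E w));
    last by ring.
rewrite [(`|t - _|)]ger0_norm ?subr_ge0 //.
have := @E_incr j (setc w j t) (w 0 j) (setc_cube j cw t01).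
by rewrite setc_eq setcK setc_id wt andbT; apply; case/andP: (cw j).
Qed.

Let G_osc j s t : 0 <= s <= 1 -> 0 <= t <= 1 ->
  `|G j t - G j s - (t - s)| <= b `|t - s|.
Proof.
move=> /andP[s0 s1] /andP[t0 t1]; have [st|/ltW ts] := leP s t.
  by rewrite [(`|t - s|)]ger0_norm ?subr_ge0 //; exact: G_incr.
rewrite [in b _]distrC [in b _]ger0_norm ?subr_ge0 //; have := G_incr j t0 ts s1.
by rewrite -normrN; congr (`|_| <= _); ring.
Qed.

Lemma emp_copula_approx u v : cube u ->
  (forall j i, ((tnth (x i) j)%:E <= emp_quantile x n j (u 0%R j))%E ->
     tnth (U i) j <= v 0 j) ->
  (forall j, n%:R^-1 * (\sum_(i < n) ((tnth (U i) j <= v 0 j)%R%:R -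
      ((tnth (x i) j)%:E <= emp_quantile x n j (u 0%R j))%E%:R)) <= c1 * l) ->
  `|emp_copula x n u - E v| <= d%:R * (c1 * l).
Proof.
move=> cu Hle Hsum; rewrite distrC /emp_copula /E /emp_cdf -mulrBr -sumrB.
pose B i j := ((tnth (x i) j)%:E <= emp_quantile x n j (u 0%R j))%E.
pose B' i j := ((tnth (U i) j)%:E <= (v 0%R j)%:E)%E.
have BB i j : B i j -> B' i j by rewrite /B' lee_fin; exact: Hle.
have gap (i : 'I_n) := forall_indicator_gap R (BB i).
rewrite ger0_norm; last first.
  rewrite mulr_ge0 ?invr_ge0 // sumr_ge0 // => i _.
  by have /andP[] := gap i.
apply: (@le_trans _ _ (n%:R^-1 * \sum_(i < n) \sum_j ((B' i j)%:R - (B i j)%:R))).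
  rewrite ler_wpM2l ?invr_ge0 //; apply: ler_sum => i _.
  by have /andP[] := gap i.
rewrite exchange_big mulr_sumr /=.
apply: (@le_trans _ _ (\sum_(j < d) c1 * l)).
  apply: ler_sum => j _; apply: le_trans (Hsum j).
  by rewrite /B'; under eq_bigr do rewrite lee_fin.
by rewrite sumr_const card_ord mulr_natl.
Qed.

Let m_ u j := Num.min (u 0 j) (1 - u 0 j).

Let beta u j := G j (u 0 j) - u 0 j.

(** As [G] equals 0 at 0 and 1 at 1, [beta] is, up to sign, an increment of the centred process from
    the nearer endpoint. *)
Let beta_le u j : cube u -> `|beta u j| <= b (m_ u j).
Proof.
move=> cu; have /andP[u0 u1] := cu j; rewrite /m_ /beta /Num.min; case: ifP => _.
  by have := G_incr j (lexx 0) u0 u1; rewrite G0 !subr0.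
by have := G_incr j u0 u1 (lexx 1); rewrite G1 -normrN; congr (`|_| <= _); ring.
Qed.

(** In units of [rho]: [M0] bounds the oscillation between u and v, [r0] the error of v_j - u_j =
    -beta_j, [bb] the size of beta_j near a face. [Mj] covers both cases of [coordinate_term]. *)
Let M0 := A * (c2 + 1).
Let r0 := M0 + c1.
Let bb := A * (4 * c2 + 1).
Let Mj := 2 * bb + r0 + 8 * K * d%:R * c2 * A.

(** The cases are separated at m = 4 [c2] a: beyond it a displacement of at most [c2] a is at most
    m/4, so u_j (1 - u_j) and its analogue at the intermediate point are at least m/4, and the
    second derivatives are O(1/m) between them. *)
Let coordinate_term u v w j : cube u -> cube v ->
  (forall k, `|v 0 k - u 0 k| <= c2 * a) ->
  `|v 0 j - u 0 j + beta u j| <= r0 * rho ->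
  (forall k, w 0 k = u 0 k \/ w 0 k = v 0 k) -> w 0 j = u 0 j ->
  `|C (setc w j (v 0 j)) - C w - - (Cdot C j u * beta u j)| <= Mj * rho.
Proof.
move=> cu cv vu rj wuv wj; rewrite opprK.
have K0 := K_gt0; have a0 := a_gt0; have l0 := l_gt0; have la := le_la.
have A0 := A_ge0; have rho0 := rho_ge0.
have c20 : 2 <= c2 by rewrite /c2; lra.
have cw : cube w by move=> k; case: (wuv k) => ->.
have /andP[u0 u1] := cu j.
set r := v 0 j - u 0 j + beta u j in rj.
have K80 : 0 <= 8 * K * d%:R * c2 * A * rho by rewrite !mulr_ge0 //; lra.
have r00 : 0 <= r0 * rho by exact: le_trans rj.
have ME : Mj * rho = 2 * (bb * rho) + r0 * rho + 8 * K * d%:R * c2 * A * rho.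
  by rewrite /Mj; ring.
(* On the two faces [beta] is 0; elsewhere [Cdot_le1] applies. *)
have Cdot_beta : `|Cdot C j u * beta u j| <= `|beta u j|.
  have [u0'|u0'] := eqVneq (u 0 j) 0.
    by rewrite /beta u0' G0 subrr mulr0.
  have [u1'|u1'] := eqVneq (u 0 j) 1.
    by rewrite /beta u1' G1 subrr mulr0.
  rewrite normrM ler_piMl //; apply: Cdot_le1 => //; split => //=.
  by rewrite !lt_def u0' u0 eq_sym u1' u1.
have [mle|mgt] := leP (m_ u j) (4 * c2 * a).
  have bj : `|beta u j| <= bb * rho.
    apply: le_trans (beta_le j cu) _; apply: b_rho => //; lra.
  have dC : `|C (setc w j (v 0 j)) - C w| <= `|r| + `|beta u j|.
    apply: le_trans (C_coord_lip C_lip j cw (cv j)) _; rewrite wj.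
    by rewrite (_ : v 0 j - u 0 j = r - beta u j) ?ler_normB // /r; ring.
  apply: le_trans (ler_normD _ _) _.
  by rewrite ME; lra.
have mu : m_ u j <= u 0 j by rewrite ge_min lexx.
have m1u : m_ u j <= 1 - u 0 j by rewrite ge_min lexx orbT.
have u01 : 0 < u 0 j < 1 by apply/andP; split; nra.
have m0 : 0 < m_ u j by nra.
have [|||s [sv s01] E1] := @C_mvt _ _ _ C_lip C_diff1 j w (v 0 j).
- exact: cw.
- by rewrite wj.
- exact: cv.
rewrite wj in sv E1; rewrite E1.
set w' := setc w j s.
have cw' : cube w'.
  by apply: setc_cube => //; case/andP: s01 => /ltW -> /ltW ->.
have Vw' : Vset j w' by split => //; rewrite /= setc_eq.
have Vu : Vset j u by [].
rewrite (_ : _ + _ = (Cdot C j u - Cdot C j w') * beta u j + Cdot C j w' * r); last first.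
  by rewrite /r; ring.
have w1 := Cdot_le1 C_lip C_diff1 Vw'.
have su : `|s - u 0 j| <= m_ u j / 4.
  by apply: le_trans sv _; apply: le_trans (vu j) _; lra.
have kap0 : 0 < m_ u j / 4 by rewrite divr_gt0.
have ku : m_ u j / 4 <= u 0 j * (1 - u 0 j) by nra.
have kw : m_ u j / 4 <= w' 0 j * (1 - w' 0 j).
  move: su; rewrite setc_eq ler_norml => /andP[s1 s2]; nra.
have w'u : \sum_i `|u 0 i - w' 0 i| <= d%:R * (c2 * a).
  apply: (@le_trans _ _ (\sum_(i < d) c2 * a)).
    apply: ler_sum => i _; rewrite distrC setcE; case: eqP => [->|_].
      by apply: le_trans sv _.
    by case: (wuv i) => ->; [rewrite subrr normr0 mulr_ge0 //; lra|].
  by rewrite sumr_const card_ord mulr_natl.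
have dCd : `|Cdot C j u - Cdot C j w'| <= K / (m_ u j / 4) * (d%:R * (c2 * a)).
  apply: le_trans (Cdot_lip C_diff1 K_gt0 C_diff2 cw' cu kap0 kw ku) _.
  by rewrite ler_wpM2l // divr_ge0 ?ltW.
have bm : `|beta u j| <= A * (2 * Num.sqrt (m_ u j * l)).
  apply: le_trans (beta_le j cu) _; apply: b_le; first by rewrite mulr_ge0 ?sqrtr_ge0.
  rewrite exprMn sqr_sqrtr ?mulr_ge0 ?(ltW m0) ?(ltW l0) //.
  have lm : l <= m_ u j by nra.
  by rewrite mulrA ler_wpM2r ?(ltW l0) // expr2; lra.
(* The square of the left side is (a l) (a / m), and a <= m in this case. The growth 1/m of the
   second derivatives is thus compensated by the smallness of [beta]. *)
have am : a / m_ u j * Num.sqrt (m_ u j * l) <= rho.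
  apply: le_sqrtr; first by rewrite mulr_ge0 ?sqrtr_ge0 // divr_ge0 ?ltW.
  rewrite exprMn sqr_sqrtr ?mulr_ge0 ?(ltW m0) ?(ltW l0) //.
  rewrite [leLHS](_ : _ = a * l * (a / m_ u j)); last by field; rewrite gt_eqF.
  by rewrite ler_piMr ?mulr_ge0 ?(ltW a0) ?(ltW l0) // ler_pdivrMr // mul1r; nra.
apply: le_trans (ler_normD _ _) _; rewrite !normrM.
have t1 : `|Cdot C j u - Cdot C j w'| * `|beta u j| <= 8 * K * d%:R * c2 * A * rho.
  apply: le_trans (ler_pM (normr_ge0 _) (normr_ge0 _) dCd bm) _.
  rewrite [leLHS](_ : _ = (8 * K * d%:R * c2 * A) *
    (a / m_ u j * Num.sqrt (m_ u j * l))); last by field; rewrite gt_eqF.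
  by rewrite ler_wpM2l // !mulr_ge0 //; lra.
have t2 : `|Cdot C j w'| * `|r| <= r0 * rho.
  by apply: le_trans rj; rewrite ler_piMl.
have bb0 : 0 <= bb * rho by rewrite !mulr_ge0 //; lra.
by rewrite ME; lra.
Qed.

Lemma copula_process_bound u : cube u ->
  `|emp_copula x n u - E u + \sum_j Cdot C j u * (G j (u 0 j) - u 0 j)| <=
  d%:R * (c1 + M0 + Mj) * rho.
Proof.
move=> cu; have /choice[v0 Hv] := fun j => quantile_coord j (cu j).
pose v : 'rV[R]_d := \row_j v0 j.
have vE j : v 0 j = v0 j by rewrite mxE.
have cv : cube v by move=> j; rewrite vE; case: (Hv j).
have Gv j : `|G j (v 0 j) - u 0 j| <= c1 * l by rewrite vE; case: (Hv j).
have vu j : `|v 0 j - u 0 j| <= c2 * a.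
  rewrite (_ : _ - _ = (G j (v 0 j) - u 0 j) - (G j (v 0 j) - v 0 j)); last by ring.
  apply: le_trans (ler_normB _ _) _.
  have h1 := Gv j; have h2 := G_unif j (cv j).
  have : c1 * l <= c1 * a by rewrite ler_wpM2l // (le_trans _ c1_ge1).
  by rewrite /c2 /c1 in h1 *; lra.
have bvu j : b `|v 0 j - u 0 j| <= M0 * rho.
  apply: b_rho (vu j); rewrite /c2; have := A_ge0; lra.
have cl : c1 * l <= c1 * rho by rewrite ler_wpM2l // (le_trans _ c1_ge1).
have T1 : `|emp_copula x n u - E v| <= d%:R * (c1 * rho).
  apply: (@le_trans _ _ (d%:R * (c1 * l))); last by rewrite ler_wpM2l.
  apply: emp_copula_approx => // j.
    by move=> i; rewrite vE; case: (Hv j) => _ _ h _; exact: h.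
  by rewrite vE; case: (Hv j).
have T2 : `|(E v - C v) - (E u - C u)| <= d%:R * (M0 * rho).
  have := @telescope_coord R d (fun w => E w - C w) u v (fun=> 0)
    (fun j => b `|v 0 j - u 0 j|).
  rewrite big1 // subr0 => H; apply: le_trans (H _) _.
    move=> j w wuv wj; rewrite subr0 -wj.
    rewrite (_ : _ - _ = E (setc w j (v 0 j)) - E w - (C (setc w j (v 0 j)) - C w));
      last by ring.
    by apply: E_osc => // k; case: (wuv k) => ->.
  apply: (@le_trans _ _ (\sum_(j < d) M0 * rho)); first exact: ler_sum.
  by rewrite sumr_const card_ord mulr_natl.
(* Bahadur's representation of the quantile: [G] at v_j is nearly u_j, and the centred process
   changes little from u_j to v_j. *)
have rj j : `|v 0 j - u 0 j + beta u j| <= r0 * rho.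
  have h := G_osc j (cu j) (cv j).
  rewrite (_ : _ + _ = (G j (v 0 j) - u 0 j) -
     (G j (v 0 j) - G j (u 0 j) - (v 0 j - u 0 j))); last by rewrite /beta; ring.
  apply: le_trans (ler_normB _ _) _; have h2 := bvu j; have h3 := Gv j.
  by rewrite /r0 mulrDl; lra.
have T3 : `|C v - C u - \sum_j - (Cdot C j u * beta u j)| <= d%:R * (Mj * rho).
  apply: (@le_trans _ _ (\sum_(j < d) Mj * rho)).
    apply: telescope_coord => j w wuv wj.
    exact: coordinate_term cu cv vu (rj j) wuv wj.
  by rewrite sumr_const card_ord mulr_natl.
rewrite sumrN opprK in T3.
rewrite (_ : _ + _ = (emp_copula x n u - E v) + ((E v - C v) - (E u - C u)) +
  (C v - C u + \sum_j Cdot C j u * beta u j)); last by rewrite /beta; ring.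
apply: le_trans (ler_normD _ _) _; apply: le_trans (lerD (ler_normD _ _) (lexx _)) _.
rewrite [leRHS](_ : _ = d%:R * (c1 * rho) + d%:R * (M0 * rho) + d%:R * (Mj * rho)).
  by apply: lerD => //; exact: lerD.
by ring.
Qed.

End deterministic_bound.

(** * Almost sure bound *)

Lemma powR_frac_exprn (R : realType) (y : R) m : 0 <= y ->
  (y `^ (1 / m.+1%:R)) ^+ m.+1 = y.
Proof.
move=> y0; rewrite -powR_mulrn ?powR_ge0 // -powRrM.
by rewrite div1r mulVf ?pnatr_eq0 // powRr1.
Qed.

(** The form in which sqrt n times sqrt(a_n l_n) appears; fourth powers remove the fractional
    exponents. *)
Lemma rateE (R : realType) n : (0 < n)%N -> 0 <= ln n%:R :> R ->
  0 <= ln (ln n%:R) :> R ->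
  rate R n = Num.sqrt (Num.sqrt (ln (ln n%:R) / n%:R) * ln n%:R).
Proof.
move=> n0 L0 LL0; set L := ln n%:R in L0 LL0 *; set LL := ln L in LL0 *.
have n0' : 0 < n%:R :> R by rewrite ltr0n.
have h1 : (L `^ (1 / 2)) ^+ 4 = L ^+ 2 by rewrite -[4%N]/(2 * 2)%N exprM powR_frac_exprn.
have h2 : (LL `^ (1 / 4)) ^+ 4 = LL by rewrite powR_frac_exprn.
have h3 : ((n%:R : R) `^ (- (1 / 4))) ^+ 4 = n%:R^-1.
  by rewrite powRN exprVn powR_frac_exprn.
apply/eqP; rewrite -(@eqrXn2 _ 4) //; last by rewrite !mulr_ge0 // powR_ge0.
rewrite /rate -/L -/LL !exprMn h1 h2 h3 -[4%N]/(2 * 2)%N exprM.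
rewrite sqr_sqrtr ?mulr_ge0 ?sqrtr_ge0 // exprMn sqr_sqrtr ?divr_ge0 //.
by apply/eqP; ring.
Qed.

Lemma le_norm_of_scaled (R : rcfType) (m A y z : R) : 0 < m ->
  `|m * y| <= A * Num.sqrt (m ^+ 2 * z) -> `|y| <= A * Num.sqrt z.
Proof.
move=> m0; rewrite normrM (gtr0_norm m0) (sqrtrM _ (exprn_ge0 _ (ltW m0))).
by rewrite sqrtr_sqr (gtr0_norm m0) mulrCA ler_pM2l.
Qed.

(** From ln 2 >= 1/2 follows L = ln n >= 6, so L^2 <= L^3 / 6 <= e^L = n. The second claim serves to
    show l_n <= a_n. *)
Lemma ln_large (R : realType) n : (2 ^ 12 <= n)%N ->
  6 <= ln n%:R :> R /\ (ln n%:R) ^+ 2 <= n%:R :> R.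
Proof.
move=> nn; have n0 : 0 < n%:R :> R by rewrite ltr0n (leq_trans _ nn) // expn_gt0.
have l6 : 6 <= ln n%:R :> R.
  apply: (@le_trans _ _ (ln (2 ^+ 12))).
    by rewrite lnXn // -mulr_natl; have := ln2_ge R; lra.
  by rewrite ler_ln ?posrE ?exprn_gt0 // -natrX ler_nat.
split => //; have l0 : 0 <= ln n%:R :> R by lra.
have := @expR_ge1Dxn R (ln n%:R) 2 l0; rewrite lnK ?posrE //.
apply: le_trans; set L := ln _ in l6 l0 *.
rewrite (_ : 3`!%:R = 6 :> R) // exprS.
have : L ^+ 2 * 6 <= L ^+ 2 * L by rewrite ler_wpM2l // exprn_ge0.
lra.
Qed.

Section assembly.
Context (R : realType) (d : nat) (dT : measure_display) (T : measurableType dT).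
Variables (P : probability T R) (X : nat -> {RV P >-> d.-tuple R}).
Hypothesis X_indep : mutually_independent X.
Hypothesis X_idd : identically_distributed X.
Variable C : 'rV[R]_d -> R.
Let mu : probability (d.-tuple R) R := distribution P (X 0%N).
Hypothesis margins_cont : forall j : 'I_d, continuous (margin_cdf mu j).
Hypothesis C_copula : copula_of C mu.
Implicit Types (u : 'rV[R]_d) (j k : 'I_d).

Let f := margin_map mu.
Let mf := measurable_margin_map margins_cont.
Let unif := margin_map_unif margins_cont.
Let U w := margin_transform mu (fun i => X i w).

Let UE w i j : tnth (U w i) j = f j (X i w).
Proof. by rewrite tnth_mktuple. Qed.

Lemma margin_transform_gt0_ae : {ae P, forall w, forall i j, 0 < tnth (U w i) j}.
Proof.
apply: ae_foralln => i; pose Z j := [set y | f j y <= 0].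
have mZ j : measurable (Z j) by exact: measurable_le_coord.
have mE j : measurable (X i @^-1` Z j).
  by rewrite -[X in measurable X]setTI; exact: measurable_funP.
have PE j : (P (X i @^-1` Z j) <= (0 : R)%:E)%E.
  have := @unif j 0; rewrite lexx ler01 => /(_ isT) h.
  rewrite -[X in (X <= _)%E]/(distribution P (X i) (Z j)) (X_idd i 0%N) //.
  by rewrite -/mu -prE // -/(Z j) h.
have [mU PU] := pr_exists_le mE PE.
exists [set w | exists j, (X i @^-1` Z j) w]; split => //.
  apply/eqP; rewrite eq_le measure_ge0 andbT; apply: le_trans PU _.
  by rewrite big1.
move=> w /= h; apply: contrapT => nh; apply: h => j; rewrite UE ltNge.
by apply/negP => h; apply: nh; exists j.
Qed.

Lemma alpha_margin_lil w n j t A : (0 < n)%N ->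
  (forall i j, 0 < tnth (U w i) j) ->
  `|\sum_(0 <= i < n) (\1_(itv_coord f j 0 t) (X i w) - t)| <=
    A * Num.sqrt (n%:R * ln (ln n%:R)) ->
  `|emp_margin (U w) n j t - t| <= A * Num.sqrt (ln (ln n%:R) / n%:R).
Proof.
move=> n0 U0 h; have n0' : 0 < n%:R :> R by rewrite ltr0n.
apply: (le_norm_of_scaled n0').
rewrite (_ : n%:R ^+ 2 * _ = n%:R * ln (ln n%:R)); last first.
  by field; rewrite gt_eqF.
rewrite mulrBr /emp_margin mulrA mulfV ?gt_eqF // mul1r.
move: h; rewrite big_mkord sumrB sumr_const card_ord -[t *+ n]mulr_natl.
congr (`|_ - _| <= _); apply: eq_bigr => i _; rewrite indicE.
congr (nat_of_bool _)%:R; apply/idP/idP; first by rewrite inE UE => -[].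
by move=> h; rewrite inE; split; rewrite -UE.
Qed.

Lemma emp_cdf_incr w n j u s A : (0 < n)%N -> cube u -> 0 <= s <= u 0 j ->
  `|\sum_(0 <= i < n) (\1_(box_set f u j s) (X i w) - pr mu (box_set f u j s))| <=
    A * Num.sqrt ((n%:R * (u 0 j - s) + ln n%:R) * ln n%:R) ->
  `|emp_cdf (U w) n (fun k => (u 0%R k)%:E) -
    emp_cdf (U w) n (fun k => (setc u j s 0%R k)%:E) - (C u - C (setc u j s))| <=
  A * Num.sqrt ((u 0 j - s + ln n%:R / n%:R) * (ln n%:R / n%:R)).
Proof.
move=> n0 cu /andP[s0 su] h; have n0' : 0 < n%:R :> R by rewrite ltr0n.
apply: (le_norm_of_scaled n0').
rewrite (_ : n%:R ^+ 2 * _ = (n%:R * (u 0 j - s) + ln n%:R) * ln n%:R);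
  last by field; rewrite gt_eqF.
have cs : cube (setc u j s).
  by apply: setc_cube => //; case/andP: (cu j) => _ u1; rewrite s0 (le_trans su).
move: h; rewrite big_mkord sumrB sumr_const card_ord -[_ *+ n]mulr_natl.
have HC := pr_joint_margin margins_cont C_copula.
rewrite (pr_box_set mu mf su) (HC _ cu) (HC _ cs)
  [n%:R * (_ - (C u - _))]mulrBr; congr (`|_ - _| <= _).
rewrite /emp_cdf -mulrBr mulrA mulfV ?gt_eqF // mul1r -sumrB.
apply: eq_bigr => i _; rewrite indicE.
set b1 := [forall j, _]; set b2 := [forall j, _].
have b1E : b1 = [forall k, f k (X i w) <= u 0 k].
  by apply: eq_forallb => k; rewrite lee_fin UE.
have b2E : b2 = b1 && (f j (X i w) <= s).
  apply/forallP/andP => [h|[/forallP h1 h2] k].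
    split; last by have := h j; rewrite lee_fin UE setc_eq.
    apply/forallP => k; have := h k; rewrite !lee_fin setcE.
    by case: eqP => // -> /le_trans; apply.
  by have := h1 k; rewrite !lee_fin setcE; case: eqP => // ->; rewrite UE.
have -> : (X i w \in box_set f u j s) = b1 && (s < f j (X i w)).
  apply/idP/andP; rewrite inE.
    by move=> [h1 h2]; split => //; rewrite b1E; apply/forallP.
  by move=> [h1 h2]; split => // k; move: h1; rewrite b1E => /forallP.
rewrite b2E; case: b1 {b1E b2E} => /=; last by rewrite subr0.
by case: leP => _; rewrite ?subrr ?subr0.
Qed.

(** Marginal intervals are boxes whose other upper ends are 1, so the estimate for boxes covers
    them. *)
Lemma emp_margin_incr w n j s t A : (0 < n)%N -> 0 <= s -> s <= t -> t <= 1 ->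
  `|\sum_(0 <= i < n) (\1_(box_set f (setc (const_mx 1) j t) j s) (X i w) -
     pr mu (box_set f (setc (const_mx 1) j t) j s))| <=
    A * Num.sqrt ((n%:R * (t - s) + ln n%:R) * ln n%:R) ->
  `|emp_margin (U w) n j t - emp_margin (U w) n j s - (t - s)| <=
  A * Num.sqrt ((t - s + ln n%:R / n%:R) * (ln n%:R / n%:R)).
Proof.
move=> n0 s0 st t1 h; have n0' : 0 < n%:R :> R by rewrite ltr0n.
apply: (le_norm_of_scaled n0').
rewrite (_ : n%:R ^+ 2 * _ = (n%:R * (t - s) + ln n%:R) * ln n%:R);
  last by field; rewrite gt_eqF.
have BE : box_set f (setc (const_mx 1) j t) j s = itv_coord f j s t.
  apply/seteqP; split => y [h1 h2]; split => //.
    by have := h1 j; rewrite setc_eq.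
  move=> k; rewrite setcE mxE; case: eqP => [->//|_].
  exact: margin_cdf_le1.
move: h; rewrite big_mkord sumrB sumr_const card_ord -[_ *+ n]mulr_natl BE.
rewrite (pr_itv mf unif j s0 st t1) [n%:R * (_ - _ - (t - s))]mulrBr.
congr (`|_ - _| <= _).
rewrite /emp_margin -mulrBr mulrA mulfV ?gt_eqF // mul1r -sumrB.
apply: eq_bigr => i _; rewrite indicE !UE.
have -> : (X i w \in itv_coord f j s t) = (s < f j (X i w)) && (f j (X i w) <= t).
  by apply/idP/andP; rewrite inE.
case: (leP (f j (X i w)) s) => [h|_] /=; last by rewrite subr0.
by rewrite (le_trans h st) subrr.
Qed.

End assembly.

Theorem proposition4p2 (R : realType) (d : nat) (d_gt0 : (0 < d)%N)
  (dT : measure_display) (T : measurableType dT) (P : probability T R)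
  (X : nat -> {RV P >-> d.-tuple R})
  (X_indep : mutually_independent X)
  (X_idd : identically_distributed X)
  (C : 'rV[R]_d -> R)
  (margins_cont : forall j : 'I_d, continuous (margin_cdf (distribution P (X 0%N)) j))
  (C_copula : copula_of C (distribution P (X 0%N)))
  (C_diff1 : forall j : 'I_d,
     (forall u, Vset j u -> derivable C u (unit_vec j)) /\
     {within Vset j, continuous (Cdot C j)})
  (C_diff2 : forall i j : 'I_d,
     (forall u, (Vset i `&` Vset j) u -> derivable (Cdot C j) u (unit_vec i)) /\
     {within Vset i `&` Vset j, continuous (Cddot C i j)} /\
     exists K : R, 0 < K /\
       forall u, (Vset i `&` Vset j) u ->
         `|Cddot C i j u| <=
         K * Num.min (1 / (u 0 i * (1 - u 0 i))) (1 / (u 0 j * (1 - u 0 j)))) :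
  {ae P, forall w : T,
    let x := fun i => X i w in
    let U := margin_transform (distribution P (X 0%N)) x in
    ebigO
      (fun n => ereal_sup
         [set `|emp_copula_process C x n u - approx_process C U n u|%:E
            | u in cube])
      (@rate R)}.
Proof.
have [K K0 C_diff2'] : exists2 K : R, 0 < K & forall i j u, (Vset i `&` Vset j) u ->
    derivable (Cdot C j) u (unit_vec i) /\
    `|Cddot C i j u| <= K * (1 / (u 0 j * (1 - u 0 j))).
  have /choice[Kf HK] : forall ij : 'I_d * 'I_d, exists K : R, 0 < K /\
      forall u, (Vset ij.1 `&` Vset ij.2) u -> `|Cddot C ij.1 ij.2 u| <=
      K * Num.min (1 / (u 0 ij.1 * (1 - u 0 ij.1))) (1 / (u 0 ij.2 * (1 - u 0 ij.2))).
    by move=> [i j]; have [_ [_ H]] := C_diff2 i j.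
  have S0 : 0 <= \sum_ij Kf ij by apply: sumr_ge0 => ij _; apply/ltW; case: (HK ij).
  (* The sum dominates the constant of every pair; the 1 makes positivity immediate. *)
  exists (1 + \sum_ij Kf ij); first by rewrite ltr_wpDr.
  move=> i j u uV; split; first exact: (C_diff2 i j).1.
  have [_ /(_ u uV) /le_trans] := HK (i, j); apply.
  have u0 : 0 <= 1 / (u 0 j * (1 - u 0 j)).
    case: uV => _ [_ /= /andP[? ?]].
    by rewrite divr_ge0 // mulr_ge0 ?subr_ge0 ?ltW.
  have Kij : 0 <= Kf (i, j) by apply/ltW; case: (HK (i, j)).
  apply: (@le_trans _ _ (Kf (i, j) * (1 / (u 0 j * (1 - u 0 j))))).
    by rewrite ler_wpM2l // ge_min lexx orbT.
  rewrite ler_wpM2r // (bigD1 (i, j)) //= addrCA lerDl addr_ge0 //.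
  by apply: sumr_ge0 => ij _; apply/ltW; case: (HK ij).
pose mu := distribution P (X 0%N).
have mf := measurable_margin_map margins_cont.
have unif := margin_map_unif margins_cont.
have C_lip := copula_lip C_copula.
apply: filterS3 (margin_transform_gt0_ae X_idd margins_cont)
  (lil_ae X_indep X_idd mf unif) (box_ae X_indep X_idd mf unif).
move=> w U0 [A1 [n1 [A10 HA1]]] [A2 [n2 [A20 HA2]]].
pose x i := X i w; pose U := margin_transform mu x.
(* The maximum with 1 ensures [l <= a] below. *)
pose A := Num.max A1 1.
pose c1 : R := 1 + 2 * A2; pose c2 : R := 2 + 2 * A2.
pose M : R := d%:R * (c1 + A2 * (c2 + 1) + (2 * (A2 * (4 * c2 + 1)) +
  (A2 * (c2 + 1) + c1) + 8 * K * d%:R * c2 * A2)).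
have A_ge1 : 1 <= A by rewrite le_max lexx orbT.
have M0 : 0 <= M.
  by rewrite mulr_ge0 // /c1 /c2 !(addr_ge0, mulr_ge0) // ltW.
rewrite /ebigO; near=> k.
have kM : M * Num.sqrt A <= k.
  by near: k; apply: nbhs_pinfty_ge; exact: num_real.
exists (n1 + n2 + 2 ^ 12)%N => // n /= nn.
have n0 : (0 < n)%N by apply: leq_trans nn; rewrite addn_gt0 expn_gt0 orbT.
have n0' : 0 < n%:R :> R by rewrite ltr0n.
have nn1 : (n1 <= n)%N by apply: leq_trans nn; rewrite -addnA leq_addr.
have nn2 : (n2 <= n)%N by apply: leq_trans nn; rewrite addnAC leq_addl.
have [L6 L2n] := @ln_large R n (leq_trans (leq_addl _ _) nn).
have LL1 : 1 <= ln (ln n%:R) :> R.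
  apply: le_trans (@ln_ge1 R 6 isT) _; rewrite ler_ln ?posrE //; lra.
set L := ln n%:R in L6 L2n LL1; set LL := ln L in LL1.
have L0 : 0 <= L by lra.
have LL0 : 0 <= LL by lra.
pose l := L / n%:R; pose a := A * Num.sqrt (LL / n%:R).
have l0 : 0 < l by rewrite divr_gt0 //; lra.
have la : l <= a.
  apply: (@le_trans _ _ (Num.sqrt (LL / n%:R))); last by rewrite ler_peMl ?sqrtr_ge0.
  apply: le_sqrtr; first exact: ltW.
  apply: (@le_trans _ _ n%:R^-1); last by rewrite ler_peMl ?invr_ge0.
  rewrite expr_div_n ler_pdivrMr ?exprn_gt0 //.
  by rewrite [n%:R ^+ 2]expr2 mulKf ?gt_eqF.
have bound u : cube u ->
    `|emp_copula_process C x n u - approx_process C U n u| <=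
    M * Num.sqrt A * rate R n.
  move=> cu.
  have D : `|emp_copula x n u - emp_cdf U n (fun k => (u 0%R k)%:E) +
      \sum_j Cdot C j u * (emp_margin U n j (u 0 j) - u 0 j)| <=
      M * Num.sqrt (a * l).
    apply: (@copula_process_bound R d C C_lip C_diff1 K K0 C_diff2'
      (margin_cdf mu) (@margin_cdf_nd R d mu) _ (margin_quantile margins_cont)
      x n n0 a l A2 l0 la (ltW A20) U0) => //.
    - by move=> j t; rewrite margin_cdf_ge0 margin_cdf_le1.
    - move=> j t t01.
      apply: le_trans (alpha_margin_lil n0 U0 (HA1 n j t nn1 t01)) _.
      by rewrite ler_wpM2r ?sqrtr_ge0 // le_max lexx.
    - move=> j s t s0 st t1.
      have t0 := le_trans s0 st.
      have cj : cube (setc (const_mx 1 : 'rV[R]_d) j t).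
        by move=> i; rewrite setcE mxE; case: eqP => _; rewrite ?t0 ?t1 ?ler01 ?lexx.
      have := HA2 n j (setc (const_mx 1) j t) s nn2 cj.
      rewrite setc_eq s0 st => /(_ isT).
      exact: emp_margin_incr.
    - move=> j v s cv s0; have := HA2 n j v s nn2 cv s0.
      exact: emp_cdf_incr.
  have -> : emp_copula_process C x n u - approx_process C U n u =
      Num.sqrt n%:R * (emp_copula x n u - emp_cdf U n (fun k => (u 0%R k)%:E) +
      \sum_j Cdot C j u * (emp_margin U n j (u 0 j) - u 0 j)).
    rewrite /emp_copula_process /approx_process /alpha /alpha_margin.
    under [in LHS]eq_bigr do rewrite mulrCA.
    by rewrite -mulr_sumr; ring.
  rewrite normrM ger0_norm ?sqrtr_ge0 //.
  apply: le_trans (ler_wpM2l (sqrtr_ge0 _) D) _.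
  rewrite rateE // -/L -/LL [leLHS]mulrCA -[leRHS]mulrA ler_wpM2l //.
  rewrite -!sqrtrM ?ler0n ?(le_trans ler01) //.
  rewrite (_ : n%:R * (a * l) = A * (Num.sqrt (LL / n%:R) * L)) //.
  by rewrite /a /l; field; rewrite gt_eqF.
(* The cube contains the origin, so the supremum is not -oo and the absolute value in [ebigO] can be
   removed. *)
have S0 : (0 <= ereal_sup [set `|emp_copula_process C x n u -
    approx_process C U n u|%:E | u in cube])%E.
  apply: (@le_trans _ _ (`|emp_copula_process C x n 0 - approx_process C U n 0|%:E)).
    by rewrite lee_fin.
  apply: ereal_sup_ubound; exists 0 => // j.
  by rewrite mxE lexx ler01.
rewrite gee0_abs //; apply: ge_ereal_sup => _ [u cu <-].
rewrite lee_fin; apply: le_trans (bound u cu) _.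
have r0 : 0 <= rate R n by rewrite !mulr_ge0 ?powR_ge0.
by rewrite ger0_norm // ler_wpM2r.
Unshelve. all: by end_near.
Qed.
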